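(* Let $M(c)$ be a cosymplectic space form with $c\neq0$, with structure $(\phi,\xi,\eta,g_M)$. Then there is no Riemannian submersion $F$ with totally geodesic fibres from $M(c)$ onto a Riemannian manifold $(N,g_N)$ such that $(\ker F_* )^\perp=\phi(\ker F_* )\oplus\{\xi\}$.
   Context: An almost contact metric structure $(\phi,\xi,\eta,g_M)$ on an odd-dimensional manifold $M$ consists of a $(1,1)$-tensor $\phi$, a vector field $\xi$, a $1$-form $\eta$ and a Riemannian metric $g_M$ with $\phi^2=-I+\eta\otimes\xi$, $\phi\xi=0$, $\eta\circ\phi=0$, $\eta(\xi)=1$, $g_M(\phi X,\phi Y)=g_M(X,Y)-\eta(X)\eta(Y)$, $\eta(X)=g_M(X,\xi)$. It is cosymplectic if it is normal and $\eta$ and $\Phi(X,Y)=g_M(X,\phi Y)$ are closed; the structure equation is $\nabla\phi=0$, and then $\nabla\xi=0$ ($\nabla$ the Levi-Civita connection of $g_M$). The $\phi$-sectional curvature is defined for unit vectors $E$ orthogonal to $\xi$ by $H(E)=g_M(R(E,\phi E)\phi E,E)$, where $R$ is the curvature tensor; a cosymplectic space form $M(c)$ is a cosymplectic manifold with constant $\phi$-sectional curvature $c$. A Riemannian submersion $F:(M,g_M)\to(N,g_N)$ is a smooth surjective map of maximal rank such that $F_*$ preserves the lengths of vectors in $(\ker F_* )^\perp$. Here $\{\xi\}$ denotes the line distribution spanned by $\xi$. *)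

(* Defs.v *)
From HB Require Import structures.
From mathcomp Require Import all_boot all_order all_algebra.
From mathcomp Require Import all_classical all_reals all_analysis.

Set Implicit Arguments.
Unset Strict Implicit.
Unset Printing Implicit Defensive.

Import Order.TTheory GRing.Theory Num.Theory.
Import numFieldNormedType.Exports.

Local Open Scope classical_set_scope.
Local Open Scope ring_scope.

(* Tangent vectors are row vectors of components in a chart, so linear maps act
   by right multiplication: a (1,1)-tensor phi sends u to [u *m phi], a 1-form
   is a column vector, and the differential of a map f of R^n sends u to
   [u *m 'J f x].  Tensor fields on a manifold are families of component
   functions, one per chart of the atlas, subject to the usual transformation
   law; these functions live on the image of the chart in R^n and their values
   outside of it are irrelevant. *)

(* Meant for open A and finite-dimensional V: then [Ck_on k A f] says that f is k times continuously
   differentiable on A. *)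
Fixpoint Ck_on (R : realType) (V W : normedModType R) (k : nat) (A : set V)
    (f : V -> W) : Prop :=
  if k is k'.+1 then
    (forall x, A x -> differentiable f x) /\
    (forall v, Ck_on k' A (fun x => 'D_v f x))
  else forall x, A x -> {for x, continuous f}.

Definition smooth_on (R : realType) (V W : normedModType R) (A : set V)
    (f : V -> W) : Prop := forall k, Ck_on k A f.

(* The continuity conditions are pointwise because [dom] and its image are
   open. *)
Record chart (R : realType) (n : nat) (T : topologicalType) := Chart {
  dom : set T;
  cmap : T -> 'rV[R]_n;
  cinv : 'rV[R]_n -> T;
  dom_open : open dom;
  img_open : open (cmap @` dom);
  cmapK : forall p, dom p -> cinv (cmap p) = p;
  cmap_continuous : forall p, dom p -> {for p, continuous cmap};
  cinv_continuous : forall x, (cmap @` dom) x -> {for x, continuous cinv} }.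

Definition img (R : realType) (n : nat) (T : topologicalType)
    (a : chart R n T) : set 'rV[R]_n := cmap a @` dom a.

Definition crep (R : realType) (n k : nat) (S T : topologicalType)
    (a : chart R n S) (b : chart R k T) (f : S -> T) : 'rV[R]_n -> 'rV[R]_k :=
  fun x => cmap b (f (cinv a x)).

Definition crep_dom (R : realType) (n k : nat) (S T : topologicalType)
    (a : chart R n S) (b : chart R k T) (f : S -> T) : set 'rV[R]_n :=
  [set x | img a x /\ dom b (f (cinv a x))].

Record manifold (R : realType) (n : nat) := Manifold {
  carrier :> topologicalType;
  idx : Type;
  atlas : idx -> chart R n carrier;
  manifold_nonempty : [set: carrier] !=set0;
  manifold_hausdorff : hausdorff_space carrier;
  manifold_second_countable : @second_countable carrier;
  atlas_cover : forall p, exists i, dom (atlas i) p;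
  atlas_compat : forall i j,
    smooth_on (crep_dom (atlas i) (atlas j) id) (crep (atlas i) (atlas j) id) }.

Definition region (R : realType) (n : nat) (M : manifold R n) (i : idx M) :
  set 'rV[R]_n := img (atlas i).

Definition trans (R : realType) (n : nat) (M : manifold R n) (i j : idx M) :
  'rV[R]_n -> 'rV[R]_n := crep (atlas i) (atlas j) id.

Definition overlap (R : realType) (n : nat) (M : manifold R n) (i j : idx M) :
  set 'rV[R]_n := crep_dom (atlas i) (atlas j) id.

Definition smooth_map (R : realType) (n k : nat) (M : manifold R n)
    (N : manifold R k) (F : M -> N) : Prop :=
  continuous F /\
  forall (i : idx M) (j : idx N),
    smooth_on (crep_dom (atlas i) (atlas j) F) (crep (atlas i) (atlas j) F).

Record vfield (R : realType) (n : nat) (M : manifold R n) := VField {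
  vf_comp :> idx M -> 'rV[R]_n -> 'rV[R]_n;
  vf_smooth : forall i, smooth_on (region i) (vf_comp i);
  vf_tensor : forall i j x, overlap i j x ->
    vf_comp i x *m 'J (trans i j) x = vf_comp j (trans i j x) }.

Record oneform (R : realType) (n : nat) (M : manifold R n) := OneForm {
  of_comp :> idx M -> 'rV[R]_n -> 'cV[R]_n;
  of_smooth : forall i, smooth_on (region i) (of_comp i);
  of_tensor : forall i j x, overlap i j x ->
    of_comp i x = 'J (trans i j) x *m of_comp j (trans i j x) }.

Record endofield (R : realType) (n : nat) (M : manifold R n) := EndoField {
  ef_comp :> idx M -> 'rV[R]_n -> 'M[R]_n;
  ef_smooth : forall i, smooth_on (region i) (ef_comp i);
  ef_tensor : forall i j x, overlap i j x ->
    ef_comp i x *m 'J (trans i j) x =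
    'J (trans i j) x *m ef_comp j (trans i j x) }.

Record metric (R : realType) (n : nat) (M : manifold R n) := Metric {
  g_comp :> idx M -> 'rV[R]_n -> 'M[R]_n;
  g_smooth : forall i, smooth_on (region i) (g_comp i);
  g_tensor : forall i j x, overlap i j x ->
    g_comp i x =
    'J (trans i j) x *m g_comp j (trans i j x) *m ('J (trans i j) x)^T;
  g_sym : forall i x, region i x -> (g_comp i x)^T = g_comp i x;
  g_pos : forall i x, region i x -> forall u : 'rV[R]_n, u != 0 ->
    0 < (u *m g_comp i x *m u^T) 0 0 }.

Definition ip (R : realType) (n : nat) (M : manifold R n) (g : metric M)
    (i : idx M) (x u v : 'rV[R]_n) : R := (u *m g i x *m v^T) 0 0.

Definition ev (R : realType) (n : nat) (M : manifold R n) (eta : oneform M)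
    (i : idx M) (x u : 'rV[R]_n) : R := (u *m eta i x) 0 0.

Definition app (R : realType) (n : nat) (M : manifold R n) (phi : endofield M)
    (i : idx M) (x u : 'rV[R]_n) : 'rV[R]_n := u *m phi i x.

Definition lie (R : realType) (n : nat) (X Y : 'rV[R]_n -> 'rV[R]_n) :
    'rV[R]_n -> 'rV[R]_n :=
  fun x => 'D_(X x) Y x - 'D_(Y x) X x.

Definition appf (R : realType) (n : nat) (M : manifold R n)
    (phi : endofield M) (i : idx M) (X : 'rV[R]_n -> 'rV[R]_n) :
    'rV[R]_n -> 'rV[R]_n :=
  fun x => app phi i x (X x).

(* Christoffel symbols: the row l of [cn_comp i x k] holds the components of
   the covariant derivative of the l-th coordinate field along the k-th one.
   The transformation law of the symbols is not part of the record: for a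
   Levi-Civita connection, the only kind used below, it follows from the
   uniqueness of the latter in each chart. *)
Record connection (R : realType) (n : nat) (M : manifold R n) := Connection {
  cn_comp :> idx M -> 'rV[R]_n -> 'I_n -> 'M[R]_n;
  cn_smooth : forall i k, smooth_on (region i) (fun x => cn_comp i x k) }.

Definition cov (R : realType) (n : nat) (M : manifold R n)
    (nabla : connection M) (i : idx M) (X Y : 'rV[R]_n -> 'rV[R]_n) :
    'rV[R]_n -> 'rV[R]_n :=
  fun x => 'D_(X x) Y x + Y x *m (\sum_(k < n) X x 0 k *: nabla i x k).

Definition levi_civita (R : realType) (n : nat) (M : manifold R n)
    (g : metric M) (nabla : connection M) : Prop :=
  forall (i : idx M) (X Y Z : 'rV[R]_n -> 'rV[R]_n),
    smooth_on (region i) X -> smooth_on (region i) Y ->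
    smooth_on (region i) Z ->
    forall x, region i x ->
      cov nabla i X Y x - cov nabla i Y X x = lie X Y x /\
      'D_(X x) (fun y => ip g i y (Y y) (Z y)) x =
        ip g i x (cov nabla i X Y x) (Z x) + ip g i x (Y x) (cov nabla i X Z x).

Definition curvature (R : realType) (n : nat) (M : manifold R n)
    (nabla : connection M) (i : idx M) (X Y Z : 'rV[R]_n -> 'rV[R]_n) :
    'rV[R]_n -> 'rV[R]_n :=
  fun x => cov nabla i X (cov nabla i Y Z) x - cov nabla i Y (cov nabla i X Z) x
           - cov nabla i (lie X Y) Z x.

Record almost_contact_metric (R : realType) (n : nat) (M : manifold R n)
    (phi : endofield M) (xi : vfield M) (eta : oneform M) (g : metric M) :
    Prop := AlmostContactMetric {
  acm_sq : forall i x, region i x -> forall u,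
    app phi i x (app phi i x u) = - u + ev eta i x u *: xi i x;
  acm_phi_xi : forall i x, region i x -> app phi i x (xi i x) = 0;
  acm_eta_phi : forall i x, region i x -> forall u,
    ev eta i x (app phi i x u) = 0;
  acm_eta_xi : forall i x, region i x -> ev eta i x (xi i x) = 1;
  acm_compat : forall i x, region i x -> forall u v,
    ip g i x (app phi i x u) (app phi i x v) =
    ip g i x u v - ev eta i x u * ev eta i x v;
  acm_eta : forall i x, region i x -> forall u,
    ev eta i x u = ip g i x u (xi i x) }.

(* No factor 1/2: in the convention with the factor, this is [2 d eta (X, Y)]. *)
Definition deta (R : realType) (n : nat) (M : manifold R n) (eta : oneform M)
    (i : idx M) (X Y : 'rV[R]_n -> 'rV[R]_n) : 'rV[R]_n -> R :=
  fun x => 'D_(X x) (fun y => ev eta i y (Y y)) x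
           - 'D_(Y x) (fun y => ev eta i y (X y)) x
           - ev eta i x (lie X Y x).

Definition Phi (R : realType) (n : nat) (M : manifold R n)
    (phi : endofield M) (g : metric M) (i : idx M) (x u v : 'rV[R]_n) : R :=
  ip g i x u (app phi i x v).

(* Up to the constant factor of the convention for d. *)
Definition dPhi (R : realType) (n : nat) (M : manifold R n)
    (phi : endofield M) (g : metric M) (i : idx M)
    (X Y Z : 'rV[R]_n -> 'rV[R]_n) : 'rV[R]_n -> R :=
  fun x => 'D_(X x) (fun y => Phi phi g i y (Y y) (Z y)) x
           + 'D_(Y x) (fun y => Phi phi g i y (Z y) (X y)) x
           + 'D_(Z x) (fun y => Phi phi g i y (X y) (Y y)) x
           - Phi phi g i x (lie X Y x) (Z x)
           - Phi phi g i x (lie Y Z x) (X x)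
           - Phi phi g i x (lie Z X x) (Y x).

Definition nijenhuis (R : realType) (n : nat) (M : manifold R n)
    (phi : endofield M) (i : idx M) (X Y : 'rV[R]_n -> 'rV[R]_n) :
    'rV[R]_n -> 'rV[R]_n :=
  fun x => app phi i x (app phi i x (lie X Y x))
           + lie (appf phi i X) (appf phi i Y) x
           - app phi i x (lie (appf phi i X) Y x)
           - app phi i x (lie X (appf phi i Y) x).

Definition normal (R : realType) (n : nat) (M : manifold R n)
    (phi : endofield M) (xi : vfield M) (eta : oneform M) : Prop :=
  forall (i : idx M) (X Y : 'rV[R]_n -> 'rV[R]_n),
    smooth_on (region i) X -> smooth_on (region i) Y ->
    forall x, region i x ->
      nijenhuis phi i X Y x + deta eta i X Y x *: xi i x = 0.

Definition closed_oneform (R : realType) (n : nat) (M : manifold R n)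
    (eta : oneform M) : Prop :=
  forall (i : idx M) (X Y : 'rV[R]_n -> 'rV[R]_n),
    smooth_on (region i) X -> smooth_on (region i) Y ->
    forall x, region i x -> deta eta i X Y x = 0.

Definition closed_Phi (R : realType) (n : nat) (M : manifold R n)
    (phi : endofield M) (g : metric M) : Prop :=
  forall (i : idx M) (X Y Z : 'rV[R]_n -> 'rV[R]_n),
    smooth_on (region i) X -> smooth_on (region i) Y ->
    smooth_on (region i) Z ->
    forall x, region i x -> dPhi phi g i X Y Z x = 0.

Record cosymplectic (R : realType) (n : nat) (M : manifold R n)
    (phi : endofield M) (xi : vfield M) (eta : oneform M) (g : metric M) :
    Prop := Cosymplectic {
  cosymplectic_acm : almost_contact_metric phi xi eta g;
  cosymplectic_normal : normal phi xi eta;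
  cosymplectic_eta : closed_oneform eta;
  cosymplectic_Phi : closed_Phi phi g }.

(* The unit vector at x orthogonal to xi is [E x]; the curvature being
   tensorial, the values of the field E at other points are irrelevant. *)
Definition constant_phi_sectional (R : realType) (n : nat) (M : manifold R n)
    (phi : endofield M) (xi : vfield M) (g : metric M) (nabla : connection M)
    (c : R) : Prop :=
  forall (i : idx M) (E : 'rV[R]_n -> 'rV[R]_n), smooth_on (region i) E ->
  forall x, region i x ->
    ip g i x (E x) (E x) = 1 -> ip g i x (E x) (xi i x) = 0 ->
    ip g i x (curvature nabla i E (appf phi i E) (appf phi i E) x) (E x) = c.

(* The differential of F at the point of coordinates x in the chart i, read in
   the chart j of N. *)
Definition pushforward (R : realType) (n k : nat) (M : manifold R n)
    (N : manifold R k) (F : M -> N) (i : idx M) (j : idx N) (x : 'rV[R]_n) :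
    'M[R]_(n, k) := 'J (crep (atlas i) (atlas j) F) x.

Definition vertical (R : realType) (n k : nat) (M : manifold R n)
    (N : manifold R k) (F : M -> N) (i : idx M) (x u : 'rV[R]_n) : Prop :=
  forall j : idx N, crep_dom (atlas i) (atlas j) F x ->
    u *m pushforward F i j x = 0.

Definition horizontal (R : realType) (n k : nat) (M : manifold R n)
    (N : manifold R k) (g : metric M) (F : M -> N) (i : idx M)
    (x u : 'rV[R]_n) : Prop :=
  forall v, vertical F i x v -> ip g i x u v = 0.

Record riemannian_submersion (R : realType) (n k : nat) (M : manifold R n)
    (N : manifold R k) (gM : metric M) (gN : metric N) (F : M -> N) : Prop :=
  RiemannianSubmersion {
  rs_smooth : smooth_map F;
  rs_surj : forall q : N, exists p : M, F p = q;
  rs_rank : forall (i : idx M) (j : idx N) x,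
    crep_dom (atlas i) (atlas j) F x -> \rank (pushforward F i j x) = k;
  rs_isometry : forall (i : idx M) (j : idx N) x,
    crep_dom (atlas i) (atlas j) F x ->
    forall u, horizontal gM F i x u ->
      ip gN j (crep (atlas i) (atlas j) F x)
        (u *m pushforward F i j x) (u *m pushforward F i j x) = ip gM i x u u }.

(* The second fundamental form of every fibre vanishes: the covariant
   derivative of a field tangent to the fibres along another one is tangent to
   the fibres. *)
Definition totally_geodesic_fibres (R : realType) (n k : nat)
    (M : manifold R n) (N : manifold R k) (nabla : connection M)
    (F : M -> N) : Prop :=
  forall (i : idx M) (U V : 'rV[R]_n -> 'rV[R]_n),
    smooth_on (region i) U -> smooth_on (region i) V ->
    (forall x, region i x -> vertical F i x (U x)) ->
    (forall x, region i x -> vertical F i x (V x)) ->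
    forall x, region i x -> vertical F i x (cov nabla i U V x).

Definition horizontal_splitting (R : realType) (n k : nat) (M : manifold R n)
    (N : manifold R k) (phi : endofield M) (xi : vfield M) (g : metric M)
    (F : M -> N) : Prop :=
  forall (i : idx M) x, region i x ->
    (forall u, horizontal g F i x u <->
       exists v a, vertical F i x v /\ u = app phi i x v + a *: xi i x) /\
    (forall v a, vertical F i x v -> app phi i x v = a *: xi i x ->
       app phi i x v = 0).

(* Main.v *)
Require Import Defs.
From mathcomp Require Import all_boot all_order all_algebra.
From mathcomp Require Import all_classical all_reals all_analysis.
From mathcomp Require Import ring lra.
Import Order.TTheory GRing.Theory Num.Theory numFieldNormedType.Exports.

(** The cosymplectic conditions give [nabla phi = 0] and [nabla xi = 0].  Since
   the horizontal part of the metric is pulled back from N, its Lie derivative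
   along vertical fields vanishes, so [g (nabla_X V, Y)] is skew in horizontal X
   and Y for V vertical.  As [nabla phi = 0], the trilinear form
   [g (nabla_(phi U) V, phi W)] on vertical fields is also symmetric in V and W,
   hence it is zero: O'Neill's tensor A vanishes.  With totally geodesic
   fibres, the vertical distribution is thus parallel, so that for E vertical
   [R (E, phi E) phi E = phi (R (E, phi E) E)] is the image by phi of a vertical
   vector, orthogonal to E, and [c = H (E) = 0]. *)

Set Implicit Arguments.
Unset Strict Implicit.
Unset Printing Implicit Defensive.

Local Open Scope classical_set_scope.
Local Open Scope ring_scope.

(** * Calculus of C^k functions *)

(** The hypotheses quantify over smooth fields on a chart, while the argument is pointwise, so every
    vector must be extended to a field. Constant fields serve for tensor identities: their brackets
    vanish, and torsion-freeness becomes symmetry of the Christoffel symbols. A vertical vector is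
    extended by projecting a constant field on the vertical distribution, which requires a smooth
    vertical projection and hence a C^k calculus that includes inverse matrices. The Lie derivative
    argument differentiates the Jacobian of F, so mixed second derivatives must commute. The
    direction of xi needs separate care: xi is horizontal and parallel, so [nabla_u V] has no xi
    component for V vertical, and skewness then settles [nabla_xi V]. *)

Lemma open_near {T : topologicalType} (A : set T) x (P : T -> Prop) :
  open A -> A x -> (forall y, A y -> P y) -> \forall y \near x, P y.
Proof.
by move=> oA Ax AP; apply: filterS AP _; apply: open_nbhs_nbhs; split.
Qed.

Section Calculus.
Context {R : realType} {V : normedModType R}.
Implicit Types (A U : set V) (x v : V).

(** A first-order expansion of [f] at [x] is also one of [g], since the remainder only sees a
    neighbourhood; uniqueness identifies the differential of [g]. *)
Lemma near_eq_differentiable {W : normedModType R} (f g : V -> W) x :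
  {near x, f =1 g} -> differentiable f x -> differentiable g x.
Proof.
move=> fg df; have fxE := nbhs_singleton fg.
have H : g \o shift x = cst (g x) + 'd f x +o_ 0 id.
  have /eqaddoP H := diff_locally df.
  apply/eqaddoP => e e0; move: (H e e0); apply: filter_app.
  have : \forall y \near (0 : V), f (y + x) = g (y + x).
    by move: fg; rewrite (near_shift 0) subr0.
  by apply: filter_app; near=> y => E; rewrite !fctE /= E fxE.
apply/diff_locallyP; rewrite (diff_unique (diff_continuous df) H).
by split=> //; exact: diff_continuous.
Unshelve. all: by end_near. Qed.

Lemma differentiable_mxP {p q : nat} (f : V -> 'M[R]_(p, q)) x :
  differentiable f x <-> forall i j, differentiable (fun y => f y i j) x.
Proof.
split=> [df i j|df].
  exact: (differentiable_comp df (differentiable_coord _ i j)).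
have -> : f = \sum_(i < p) \sum_(j < q) (fun y => f y i j *: delta_mx i j).
  apply/funext => y; rewrite [LHS]matrix_sum_delta fct_sumE.
  by apply: eq_bigr => i _; rewrite fct_sumE.
apply: differentiable_sum => i; apply: differentiable_sum => j.
exact/differentiableZl/df.
Qed.

Lemma continuous_mxP {p q : nat} (f : V -> 'M[R]_(p, q)) x :
  {for x, continuous f} <-> forall i j, {for x, continuous (fun y => f y i j)}.
Proof.
split=> [cf i j|cf].
  exact: (continuous_comp cf (@coord_continuous _ _ _ i j _)).
have -> : f = fun y => \sum_(i < p) \sum_(j < q) f y i j *: delta_mx i j.
  by apply/funext => y; rewrite [LHS]matrix_sum_delta.
rewrite /prop_for /continuous_at; apply: cvg_big => [|i _]; first exact: add_continuous.
apply: cvg_big => [|j _]; first exact: add_continuous.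
by apply: cvgZr_tmp; exact: cf.
Qed.

Section Ck.
Context {W : normedModType R}.

Lemma Ck_on_eq k A (f g : V -> W) : open A -> {in A, f =1 g} ->
  Ck_on k A f -> Ck_on k A g.
Proof.
move=> oA; elim: k f g => [|k IH] f g fg.
  move=> cf x Ax; rewrite /prop_for /continuous_at -(fg x (mem_set Ax)).
  apply: cvg_trans (cf x Ax); apply: near_eq_cvg.
  by near=> y; apply/fg/mem_set; near: y; exact: open_nbhs_nbhs.
have nfg x : A x -> {near x, f =1 g}.
  by move=> Ax; near=> y; apply/fg/mem_set; near: y; exact: open_nbhs_nbhs.
move=> [df Df]; split=> [x Ax|v].
  exact: near_eq_differentiable (nfg x Ax) (df x Ax).
apply: IH (Df v) => x /set_mem Ax; exact: near_eq_derive (nfg x Ax).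
Unshelve. all: by end_near. Qed.

Lemma Ck_on_sub k A U (f : V -> W) : A `<=` U -> Ck_on k U f -> Ck_on k A f.
Proof.
move=> AU; elim: k f => [|k IH] f; first by move=> cf x Ax; exact: (cf x (AU x Ax)).
by move=> [df Df]; split=> [x /AU|v]; [exact: (df x)|exact/IH/Df].
Qed.

(** Lets smoothness be proved separately on the domain of each chart of the target manifold. *)
Lemma Ck_on_local k A (f : V -> W) :
  (forall x, A x -> exists2 U, U x & Ck_on k U f) -> Ck_on k A f.
Proof.
elim: k f => [|k IH] f H /=; first by move=> x /H [U Ux cf]; exact: (cf x Ux).
split=> [x /H[U Ux [df _]]|v]; first exact: (df x Ux).
by apply: IH => x /H[U Ux [_ Df]]; exists U => //; exact: Df.
Qed.

Lemma Ck_onW k A (f : V -> W) : Ck_on k.+1 A f -> Ck_on k A f.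
Proof.
elim: k f => [|k IH] f [df Df] /=.
  by move=> x Ax; apply/differentiable_continuous/df.
by split=> // v; exact/IH/Df.
Qed.

Lemma Ck_on_cst k A (w : W) : Ck_on k A (fun=> w).
Proof.
elim: k w => [|k IH] w /=; first by move=> x _; exact: cvg_cst.
split=> [x _|v]; first exact: differentiable_cst.
have -> : (fun x => 'D_v (fun=> w) x) = fun=> (0 : W); last exact: IH.
by apply/funext => x; exact: derive_cst.
Qed.

Lemma Ck_onD k A (f g : V -> W) : open A ->
  Ck_on k A f -> Ck_on k A g -> Ck_on k A (fun x => f x + g x).
Proof.
move=> oA; elim: k f g => [|k IH] f g.
  by move=> cf cg x Ax; apply: cvgD; [exact: cf|exact: cg].
move=> [df Df] [dg Dg]; split=> [x Ax|v].
  by apply: differentiableD; [exact: df|exact: dg].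
apply: (Ck_on_eq oA) (IH _ _ (Df v) (Dg v)) => x /set_mem Ax.
by rewrite /= -deriveD//; apply/diff_derivable; [exact: df|exact: dg].
Qed.

Lemma Ck_on_sum k A (I : Type) (r : seq I) (P : pred I) (f : I -> V -> W) :
  open A -> (forall i, P i -> Ck_on k A (f i)) ->
  Ck_on k A (fun x => \sum_(i <- r | P i) f i x).
Proof.
move=> oA Hf; elim: r => [|i r IH].
  by under eq_fun do rewrite big_nil; exact: Ck_on_cst.
case Pi : (P i); last by under eq_fun do rewrite big_cons Pi.
by under eq_fun do rewrite big_cons Pi; apply: Ck_onD => //; exact: Hf.
Qed.

End Ck.

Lemma Ck_onM k A (f g : V -> R) : open A ->
  Ck_on k A f -> Ck_on k A g -> Ck_on k A (fun x => f x * g x).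
Proof.
move=> oA; elim: k f g => [|k IH] f g.
  by move=> cf cg x Ax; apply: cvgM; [exact: cf|exact: cg].
move=> cf cg; have [[df Df] [dg Dg]] := (cf, cg); split=> [x Ax|v].
  by apply: differentiableM; [exact: df|exact: dg].
have := Ck_onD oA (IH _ _ (Ck_onW cf) (Dg v)) (IH _ _ (Ck_onW cg) (Df v)).
apply: (Ck_on_eq oA) => x /set_mem Ax.
by rewrite /= [RHS]deriveM//; apply/diff_derivable; [exact: df|exact: dg].
Qed.

Lemma Ck_onV k A (f : V -> R) : open A -> (forall x, A x -> f x != 0) ->
  Ck_on k A f -> Ck_on k A (fun x => (f x)^-1).
Proof.
move=> oA f0; elim: k => [|k IH].
  by move=> cf x Ax; apply: cvgV; [exact: f0|exact: cf].
move=> cf; have [df Df] := cf; split=> [x Ax|v].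
  by apply: differentiableV; [exact: df|exact: f0].
(* The derivative of the inverse is minus its square times ['D_v f]; the induction hypothesis covers
   the inverse at the lower order. *)
have cfV := IH (Ck_onW cf).
have := Ck_onM oA (Ck_on_cst k A (-1 : R)) (Ck_onM oA (Ck_onM oA cfV cfV) (Df v)).
apply: (Ck_on_eq oA) => x /set_mem Ax.
rewrite /= deriveV ?f0//; last exact/diff_derivable/df.
by rewrite /GRing.scale/= mulN1r mulNr -exprVn expr2.
Qed.

Lemma Ck_on_prod k A (I : Type) (r : seq I) (P : pred I) (f : I -> V -> R) :
  open A -> (forall i, P i -> Ck_on k A (f i)) ->
  Ck_on k A (fun x => \prod_(i <- r | P i) f i x).
Proof.
move=> oA Hf; elim: r => [|i r IH].
  by under eq_fun do rewrite big_nil; exact: Ck_on_cst.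
case Pi : (P i); last by under eq_fun do rewrite big_cons Pi.
by under eq_fun do rewrite big_cons Pi; apply: Ck_onM => //; exact: Hf.
Qed.

Lemma derive_coord {p q : nat} (f : V -> 'M[R]_(p, q)) x v i j :
  differentiable f x -> ('D_v f x) i j = 'D_v (fun y => f y i j) x.
Proof. by move=> df; rewrite derive_mx ?mxE//; exact/diff_derivable. Qed.

Lemma Ck_on_mxP {p q : nat} k A (f : V -> 'M[R]_(p, q)) : open A ->
  Ck_on k A f <-> forall i j, Ck_on k A (fun x => f x i j).
Proof.
move=> oA; elim: k f => [|k IH] f /=.
  split=> [cf i j x Ax|cf x Ax]; first exact: ((continuous_mxP f x).1 (cf x Ax) i j).
  by apply/continuous_mxP => i j; exact: (cf i j x Ax).
split=> [[df Df] i j|H].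
  split=> [x Ax|v]; first exact: ((differentiable_mxP f x).1 (df x Ax) i j).
  apply: (Ck_on_eq oA) ((IH _).1 (Df v) i j) => x /set_mem Ax.
  exact/derive_coord/df.
have df x : A x -> differentiable f x.
  by move=> Ax; apply/differentiable_mxP => i j; exact: ((H i j).1 x Ax).
split=> // v; apply/IH => i j; apply: (Ck_on_eq oA) ((H i j).2 v).
by move=> x /set_mem Ax; apply/esym/derive_coord/df.
Qed.


Lemma Ck_on_scalemx {p q : nat} k A (a : V -> R) (f : V -> 'M[R]_(p, q)) :
  open A -> Ck_on k A a -> Ck_on k A f -> Ck_on k A (fun x => a x *: f x).
Proof.
move=> oA ca /(Ck_on_mxP _ _ oA) cf; apply/(Ck_on_mxP _ _ oA) => i j.
by under eq_fun do rewrite mxE; exact: Ck_onM.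
Qed.

Lemma Ck_on_mulmx {p q r : nat} k A (f : V -> 'M[R]_(p, q))
    (g : V -> 'M[R]_(q, r)) : open A ->
  Ck_on k A f -> Ck_on k A g -> Ck_on k A (fun x => f x *m g x).
Proof.
move=> oA /(Ck_on_mxP _ _ oA) cf /(Ck_on_mxP _ _ oA) cg.
apply/(Ck_on_mxP _ _ oA) => i j; under eq_fun do rewrite mxE.
by apply: Ck_on_sum => // l _; exact: Ck_onM.
Qed.

Lemma Ck_on_trmx {p q : nat} k A (f : V -> 'M[R]_(p, q)) : open A ->
  Ck_on k A f -> Ck_on k A (fun x => (f x)^T).
Proof.
move=> oA /(Ck_on_mxP _ _ oA) cf; apply/(Ck_on_mxP _ _ oA) => i j.
by under eq_fun do rewrite mxE.
Qed.

Lemma Ck_on_det {p : nat} k A (f : V -> 'M[R]_p) : open A ->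
  Ck_on k A f -> Ck_on k A (fun x => \det (f x)).
Proof.
move=> oA /(Ck_on_mxP _ _ oA) cf.
apply: Ck_on_sum => // s _; apply: Ck_onM => //; first exact: Ck_on_cst.
exact: Ck_on_prod.
Qed.

(** By Cramer's formula the entries are cofactors divided by the determinant. *)
Lemma Ck_on_invmx {p : nat} k A (f : V -> 'M[R]_p) : open A ->
  (forall x, A x -> f x \in unitmx) ->
  Ck_on k A f -> Ck_on k A (fun x => invmx (f x)).
Proof.
move=> oA fU cf; have cfij := (Ck_on_mxP _ _ oA).1 cf.
apply/(Ck_on_mxP _ _ oA) => i j.
have H : Ck_on k A (fun x => (\det (f x))^-1 * \adj (f x) i j).
  apply: Ck_onM => //.
    apply: Ck_onV => //; last exact: Ck_on_det.
    by move=> x /fU; rewrite unitmxE unitfE.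
  under eq_fun do rewrite mxE; apply: Ck_onM => //; first exact: Ck_on_cst.
  apply: Ck_on_det => //; apply/(Ck_on_mxP _ _ oA) => a b.
  by under eq_fun do rewrite !mxE.
apply: (Ck_on_eq oA) H => x /set_mem Ax.
by rewrite /= /invmx fU// [RHS]mxE.
Qed.

Lemma smooth_on_derive {W : normedModType R} A v (f : V -> W) :
  smooth_on A f -> smooth_on A (fun x => 'D_v f x).
Proof. by move=> sf k; exact: (sf k.+1).2. Qed.

Lemma smooth_on_diff {W : normedModType R} A (f : V -> W) x :
  smooth_on A f -> A x -> differentiable f x.
Proof. by move=> sf; exact: (sf 1).1. Qed.

(** * Symmetry of mixed second derivatives *)

Lemma is_derive_line (f : V -> R) x v (t : R) :
  differentiable f (x + t *: v) ->
  is_derive t 1 (fun s => f (x + s *: v)) ('D_v f (x + t *: v)).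
Proof.
move=> df; have dl : is_diff t (fun s : R => x + s *: v) ( *:%R^~ v).
  by apply: is_diff_eq; rewrite add0r.
have dlx := @ex_diff _ _ _ _ _ _ _ dl.
split; first exact/derivable1_diffP/(differentiable_comp dlx df).
rewrite [LHS](deriveE _ (differentiable_comp dlx df)).
by rewrite (diff_comp dlx df)/= diff_val scale1r deriveE.
Qed.

(** The second difference over a parallelogram is an increment in [t] of an increment in [s], so the
    one-variable mean value theorem applies twice. *)
Lemma rect_MVT (f : V -> R) x u v (h : R) : 0 < h ->
  (forall s t, 0 <= s <= h -> 0 <= t <= h ->
     differentiable f (x + s *: u + t *: v) /\
     differentiable ('D_v f) (x + s *: u + t *: v)) ->
  exists s t, [/\ 0 <= s <= h, 0 <= t <= h &
    f (x + h *: u + h *: v) - f (x + h *: u) - (f (x + h *: v) - f x) =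
    'D_u ('D_v f) (x + s *: u + t *: v) * h * h].
Proof.
move=> h0 df.
have h_itv : 0 <= h <= h by rewrite ltW/=.
have o_itv : 0 <= (0 : R) <= h by rewrite lexx ltW.
pose F t := f (x + h *: u + t *: v) - f (x + t *: v).
pose dF t := 'D_v f (x + h *: u + t *: v) - 'D_v f (x + t *: v).
have dFt t : 0 <= t <= h -> is_derive t 1 F (dF t).
  move=> ht; apply: is_deriveB; apply: is_derive_line.
    exact: (df h t h_itv ht).1.
  by have := (df 0 t o_itv ht).1; rewrite scale0r addr0.
have [||t ht FE] := @MVT R F dF 0 h h0.
- by move=> t /[!in_itv]/= /andP[t0 t1]; apply: dFt; rewrite !ltW.
- apply: derivable_within_continuous => t /[!in_itv]/= ht.
  exact: (@ex_derive _ _ _ _ _ _ _ (dFt t ht)).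
have {}ht : 0 <= t <= h by move: ht; rewrite in_itv/= => /andP[? ?]; rewrite !ltW.
pose G s := 'D_v f (x + t *: v + s *: u).
pose dG s := 'D_u ('D_v f) (x + t *: v + s *: u).
have dGs s : 0 <= s <= h -> is_derive s 1 G (dG s).
  move=> hs; apply: is_derive_line; rewrite addrAC; exact: (df s t hs ht).2.
have [||s hs GE] := @MVT R G dG 0 h h0.
- by move=> s /[!in_itv]/= /andP[s0 s1]; apply: dGs; rewrite !ltW.
- apply: derivable_within_continuous => s /[!in_itv]/= hs.
  exact: (@ex_derive _ _ _ _ _ _ _ (dGs s hs)).
have {}hs : 0 <= s <= h by move: hs; rewrite in_itv/= => /andP[? ?]; rewrite !ltW.
exists s, t; split=> //.
have -> : 'D_u ('D_v f) (x + s *: u + t *: v) * h = dF t.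
  move: GE; rewrite /dG /G /dF subr0 scale0r addr0 => GE.
  by rewrite (addrAC x (h *: u)) GE addrAC.
move: FE; rewrite /F subr0 !scale0r !addr0 => <-.
ring.
Qed.

(** The second difference is symmetric in [u] and [v], and divided by [h * h] it is a value of
    either mixed derivative near [x]; continuity at [x] concludes. *)
Lemma derive_comm (A : set V) (f : V -> R) x u v : open A -> A x ->
  smooth_on A f -> 'D_u ('D_v f) x = 'D_v ('D_u f) x.
Proof.
move=> oA Ax sf; apply/eqP; rewrite -subr_eq0 -normr_le0; apply/ler_addgt0Pl.
move=> e e0; rewrite addr0.
have cont a b : {for x, continuous (fun y => 'D_a ('D_b f) y)}.
  apply/differentiable_continuous/(@smooth_on_diff _ A) => //.
  by do 2!apply: smooth_on_derive.
have near_e a b : \forall y \near x,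
    `|'D_a ('D_b f) x - 'D_a ('D_b f) y| < e / 2.
  by have /cvgrPdist_lt := cont a b; apply; rewrite divr_gt0.
have : \forall y \near x, [/\ A y, `|'D_u ('D_v f) x - 'D_u ('D_v f) y| < e / 2
    & `|'D_v ('D_u f) x - 'D_v ('D_u f) y| < e / 2].
  by apply: filterS3 (open_nbhs_nbhs (conj oA Ax)) (near_e u v) (near_e v u) => y.
move=> /nbhs_ballP[r /= r0 rP].
(* This size keeps the parallelogram inside the ball of radius [r]; the [1] makes the denominator
   positive even if both vectors vanish. *)
pose h := r / (`|u| + `|v| + 1).
have d0 : 0 < `|u| + `|v| + 1 by rewrite ltr_pwDr// addr_ge0.
have h0 : 0 < h by rewrite divr_gt0.
have inball s t a b : `|a| + `|b| = `|u| + `|v| -> 0 <= s <= h -> 0 <= t <= h ->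
    ball x r (x + s *: a + t *: b).
  move=> ab /andP[s0 sh] /andP[t0 th]; rewrite -ball_normE/= -addrA opprD addrA.
  rewrite subrr add0r normrN (le_lt_trans (ler_normD _ _))// !normrZ.
  rewrite !ger0_norm// (@le_lt_trans _ _ (h * (`|a| + `|b|)))//.
    by rewrite mulrDr lerD// ler_wpM2r.
  by rewrite ab /h -mulrA gtr_pMr// mulrC ltr_pdivrMr// mul1r ltrDl.
have [s [t [hs ht E1]]] : exists s t, [/\ 0 <= s <= h, 0 <= t <= h &
    f (x + h *: u + h *: v) - f (x + h *: u) - (f (x + h *: v) - f x) =
    'D_u ('D_v f) (x + s *: u + t *: v) * h * h].
  apply: rect_MVT => // s t hs ht; have [Ay _ _] := rP _ (inball s t u v erefl hs ht).
  by split; apply: (@smooth_on_diff _ A) => //; exact: smooth_on_derive.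
have [s' [t' [hs' ht' E2]]] : exists s t, [/\ 0 <= s <= h, 0 <= t <= h &
    f (x + h *: v + h *: u) - f (x + h *: v) - (f (x + h *: u) - f x) =
    'D_v ('D_u f) (x + s *: v + t *: u) * h * h].
  apply: rect_MVT => // a b ha hb.
  have [Ay _ _] := rP _ (inball a b v u (addrC _ _) ha hb).
  by split; apply: (@smooth_on_diff _ A) => //; exact: smooth_on_derive.
have [_ D1 _] := rP _ (inball s t u v erefl hs ht).
have [_ _ D2] := rP _ (inball s' t' v u (addrC _ _) hs' ht').
move: E1 E2 D1 D2; rewrite (addrAC x (h *: v)).
set a := 'D_u ('D_v f) (x + s *: u + _); set b := 'D_v ('D_u f) (x + s' *: v + _).
move: a b ('D_u ('D_v f) x) ('D_v ('D_u f) x) => a b a0 b0 E1 E2 D1 D2.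
have E : a = b.
  apply: (mulIf (lt0r_neq0 h0)); apply: (mulIf (lt0r_neq0 h0)).
  by rewrite -E1 -E2; ring.
rewrite -(subrKA a) (le_trans (ler_normD _ _))//.
by rewrite [leRHS]splitr lerD ?ltW// E distrC.
Qed.

End Calculus.

(** * Derivatives of matrix-valued functions *)

Section MatrixDerivative.
Context {R : realType} {V : normedModType R}.

Lemma differentiable_mulmx {p q r : nat} (f : V -> 'M[R]_(p, q))
    (g : V -> 'M[R]_(q, r)) x : differentiable f x -> differentiable g x ->
  differentiable (fun y => f y *m g y) x.
Proof.
move=> /differentiable_mxP df /differentiable_mxP dg.
apply/differentiable_mxP => i j.
have -> : (fun y => (f y *m g y) i j) =
    \sum_(l < q) ((fun y => f y i l) * (fun y => g y l j)).
  by apply/funext => y; rewrite mxE fct_sumE.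
by apply: differentiable_sum => l; apply: differentiableM.
Qed.

Lemma derive_mulmx {p q r : nat} (f : V -> 'M[R]_(p, q))
    (g : V -> 'M[R]_(q, r)) x v : differentiable f x -> differentiable g x ->
  'D_v (fun y => f y *m g y) x = 'D_v f x *m g x + f x *m 'D_v g x.
Proof.
move=> df dg; have /differentiable_mxP dfij := df.
have /differentiable_mxP dgij := dg.
apply/matrixP => i j; rewrite derive_coord; last exact: differentiable_mulmx.
have -> : (fun y => (f y *m g y) i j) =
    \sum_(l < q) ((fun y => f y i l) * (fun y => g y l j)).
  by apply/funext => y; rewrite mxE fct_sumE.
rewrite derive_sum; last by move=> l; apply/diff_derivable/differentiableM.
rewrite !mxE -big_split/=; apply: eq_bigr => l _.
rewrite deriveM; try exact/diff_derivable.
by rewrite !derive_coord// addrC /GRing.scale/= (mulrC (g x l j)).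
Qed.

Lemma differentiable_trmx {p q : nat} (f : V -> 'M[R]_(p, q)) x :
  differentiable f x -> differentiable (fun y => (f y)^T) x.
Proof.
move=> /differentiable_mxP df; apply/differentiable_mxP => i j.
by under eq_fun do rewrite mxE.
Qed.

Lemma derive_trmx {p q : nat} (f : V -> 'M[R]_(p, q)) x v :
  differentiable f x -> 'D_v (fun y => (f y)^T) x = ('D_v f x)^T.
Proof.
move=> df; apply/matrixP => i j; rewrite derive_coord; last exact: differentiable_trmx.
by rewrite mxE derive_coord//; under eq_fun do rewrite mxE.
Qed.

Lemma derive_mulmxl {p q r : nat} (a : 'M[R]_(p, q)) (g : V -> 'M[R]_(q, r))
    x v : differentiable g x ->
  'D_v (fun y => a *m g y) x = a *m 'D_v g x.
Proof.
move=> dg; have := derive_mulmx v (differentiable_cst a x) dg.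
by rewrite derive_cst mul0mx add0r.
Qed.

End MatrixDerivative.

Lemma smooth_on_mulmx {R : realType} {V : normedModType R} {p q r : nat}
    (A : set V) (f : V -> 'M[R]_(p, q)) (g : V -> 'M[R]_(q, r)) : open A ->
  smooth_on A f -> smooth_on A g -> smooth_on A (fun x => f x *m g x).
Proof. by move=> oA sf sg k; apply: Ck_on_mulmx. Qed.

Lemma smooth_on_cst {R : realType} {V W : normedModType R} (A : set V) (w : W) :
  smooth_on A (fun=> w).
Proof. by move=> k; exact: Ck_on_cst. Qed.

(** [Ck_on] only speaks of constant directions, so the derivative along [X] is expanded in the
    coordinate directions with the components of [X] as coefficients. *)
Lemma smooth_on_derive_along {R : realType} {n p q : nat} (A : set 'rV[R]_n)
    (X : 'rV[R]_n -> 'rV[R]_n) (f : 'rV[R]_n -> 'M[R]_(p, q)) : open A ->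
  smooth_on A X -> smooth_on A f -> smooth_on A (fun x => 'D_(X x) f x).
Proof.
move=> oA sX sf k.
have H : Ck_on k A (fun x => \sum_(l < n) X x 0 l *: 'D_(delta_mx 0 l) f x).
  apply: Ck_on_sum => // l _; apply: Ck_on_scalemx => //.
    exact: ((Ck_on_mxP _ _ oA).1 (sX k)).
  exact: smooth_on_derive.
apply: (Ck_on_eq oA) H => x /set_mem Ax /=.
rewrite [in RHS](row_sum_delta (X x)) deriveE; last exact: smooth_on_diff Ax.
rewrite linear_sum/=; apply: eq_bigr => l _.
by rewrite linearZ/= deriveE//; exact: smooth_on_diff Ax.
Qed.

(** * The metric and its Levi-Civita connection in a chart *)

Section Metric.
Context {R : realType} {n : nat} {M : manifold R n} (g : metric M) (i : idx M).
Implicit Types x u v w : 'rV[R]_n.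

Lemma ipDl x u v w : ip g i x (u + v) w = ip g i x u w + ip g i x v w.
Proof. by rewrite /ip !mulmxDl mxE. Qed.
Lemma ipDr x u v w : ip g i x u (v + w) = ip g i x u v + ip g i x u w.
Proof. by rewrite /ip linearD mulmxDr mxE. Qed.
Lemma ipZl x a u v : ip g i x (a *: u) v = a * ip g i x u v.
Proof. by rewrite /ip -!scalemxAl mxE. Qed.
Lemma ipZr x a u v : ip g i x u (a *: v) = a * ip g i x u v.
Proof. by rewrite /ip linearZ/= -!scalemxAr mxE. Qed.
Lemma ipNl x u v : ip g i x (- u) v = - ip g i x u v.
Proof. by rewrite -scaleN1r ipZl mulN1r. Qed.
Lemma ipNr x u v : ip g i x u (- v) = - ip g i x u v.
Proof. by rewrite -scaleN1r ipZr mulN1r. Qed.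
Lemma ip0l x v : ip g i x 0 v = 0.
Proof. by rewrite /ip !mul0mx mxE. Qed.
Lemma ip0r x v : ip g i x v 0 = 0.
Proof. by rewrite /ip trmx0 mulmx0 mxE. Qed.

Lemma ipC x u v : region i x -> ip g i x u v = ip g i x v u.
Proof.
move=> Ax; have -> : ip g i x u v = (u *m g i x *m v^T)^T 0 0 by rewrite mxE.
by rewrite !trmx_mul trmxK g_sym// mulmxA.
Qed.

Lemma ip_eq0 x u : region i x -> (ip g i x u u == 0) = (u == 0).
Proof.
move=> Ax; have [->|u0] := eqVneq u 0; first by rewrite ip0l eqxx.
by rewrite gt_eqF//; exact: g_pos.
Qed.

Lemma region_open : open (region i).
Proof. exact: img_open. Qed.

End Metric.

Section LeviCivita.
Context {R : realType} {n : nat} {M : manifold R n} (g : metric M)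
  (nabla : connection M) (i : idx M).
Hypothesis nablaP : levi_civita g nabla.
Implicit Types x u v w : 'rV[R]_n.
Implicit Types X Y Z : 'rV[R]_n -> 'rV[R]_n.
Local Notation A := (region i).
Local Notation "<< x ; u , v >>" := (ip g i x u v).

Definition christoffel x u : 'M[R]_n := \sum_(k < n) u 0 k *: nabla i x k.

(** [cov] depends on its first field only through the value at [x]; taking a vector there avoids
    extending the direction to a field. *)
Definition cov_at x u Y : 'rV[R]_n := 'D_u Y x + Y x *m christoffel x u.

Local Notation nab := cov_at.

Lemma cov_at_linear x a u v Y : differentiable Y x ->
  nab x (a *: u + v) Y = a *: nab x u Y + nab x v Y.
Proof.
move=> dY; rewrite /cov_at !deriveE// linearP/= /christoffel.
have -> : \sum_(k < n) (a *: u + v) 0 k *: nabla i x k =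
    a *: (\sum_(k < n) u 0 k *: nabla i x k) + \sum_(k < n) v 0 k *: nabla i x k.
  rewrite scaler_sumr -big_split/=; apply: eq_bigr => k _.
  by rewrite !mxE scalerDl scalerA.
by rewrite mulmxDr -scalemxAr scalerDr addrACA.
Qed.

Lemma covE X Y x : cov nabla i X Y x = nab x (X x) Y. Proof. by []. Qed.

Lemma smooth_on_cov X Y : smooth_on A X -> smooth_on A Y ->
  smooth_on A (cov nabla i X Y).
Proof.
move=> sX sY; have oA := @region_open _ _ _ i.
have s1 := smooth_on_derive_along oA sX sY.
move=> k; apply: (Ck_onD oA (s1 k)).
apply: Ck_on_mulmx => //; apply: Ck_on_sum => // l _; apply: Ck_on_scalemx => //.
  exact: ((Ck_on_mxP _ _ oA).1 (sX k)).
exact: cn_smooth.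
Qed.

Lemma cov_at_cst x u v : nab x u (fun=> v) = v *m christoffel x u.
Proof. by rewrite /cov_at derive_cst add0r. Qed.

(** Torsion-freeness on two constant fields, whose bracket is zero. *)
Lemma christoffelC x u v : A x -> v *m christoffel x u = u *m christoffel x v.
Proof.
move=> Ax; have [H _] := nablaP (smooth_on_cst _ u) (smooth_on_cst _ v)
  (smooth_on_cst _ u) Ax.
apply/eqP; rewrite -subr_eq0; move: H; rewrite !covE !cov_at_cst => ->.
by rewrite /lie !derive_cst subrr.
Qed.

Lemma derive_ip x u Y Z : A x -> smooth_on A Y -> smooth_on A Z ->
  'D_u (fun y => <<y; Y y, Z y>>) x = <<x; nab x u Y, Z x>> + <<x; Y x, nab x u Z>>.
Proof.
move=> Ax sY sZ; exact: (nablaP (smooth_on_cst _ u) sY sZ Ax).2.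
Qed.

Lemma derive_ip_cst x u Y Z c : A x -> smooth_on A Y -> smooth_on A Z ->
  (forall y, A y -> <<y; Y y, Z y>> = c) ->
  <<x; nab x u Y, Z x>> + <<x; Y x, nab x u Z>> = 0.
Proof.
move=> Ax sY sZ YZ; rewrite -derive_ip//.
rewrite -[RHS](derive_cst c x u); apply: near_eq_derive.
exact: open_near (@region_open _ _ _ i) Ax YZ.
Qed.

End LeviCivita.

(** * Parallelism of phi and xi *)

Section Cosymplectic.
Context {R : realType} {n : nat} {M : manifold R n}
  (phi : endofield M) (xi : vfield M) (eta : oneform M) (g : metric M)
  (nabla : connection M) (i : idx M).
Hypothesis nablaP : levi_civita g nabla.
Hypothesis cosym : cosymplectic phi xi eta g.
Implicit Types x y u v w : 'rV[R]_n.
Implicit Types X Y Z : 'rV[R]_n -> 'rV[R]_n.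
Local Notation A := (region i).
Local Notation "<< x ; u , v >>" := (ip g i x u v).
Local Notation Gam := (christoffel nabla i).
Local Notation nab := (cov_at nabla i).
Local Notation f := (phi i).

Let acm := cosymplectic_acm cosym.
Let oA : open A := @region_open _ _ _ i.

(** The matrix of the endomorphism [nabla_u phi], acting on row vectors from the right: the Leibniz
    rule yields the commutator with the connection matrix. *)
Definition nabla_phi x u : 'M[R]_n := 'D_u f x + f x *m Gam x u - Gam x u *m f x.
Local Notation T := nabla_phi.

Lemma cov_at_eq x u Y Z : A x -> (forall y, A y -> Y y = Z y) ->
  nab x u Y = nab x u Z.
Proof.
move=> Ax YZ; rewrite /cov_at YZ//; congr (_ + _).
exact/near_eq_derive/(open_near oA Ax).
Qed.

Lemma smooth_on_ip Y Z : smooth_on A Y -> smooth_on A Z ->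
  smooth_on A (fun y => <<y; Y y, Z y>>).
Proof.
move=> sY sZ k.
have H : Ck_on k A (fun y => Y y *m g i y *m (Z y)^T).
  apply: Ck_on_mulmx => //; last exact: Ck_on_trmx.
  by apply: Ck_on_mulmx => //; exact: g_smooth.
exact: ((Ck_on_mxP _ _ oA).1 H 0 0).
Qed.

Lemma cov_at_mulphi x u Y : A x -> differentiable Y x ->
  nab x u (fun y => Y y *m f y) = nab x u Y *m f x + Y x *m T x u.
Proof.
move=> Ax dY; rewrite /cov_at derive_mulmx//; last first.
  exact: smooth_on_diff (@ef_smooth _ _ _ phi i) Ax.
rewrite /nabla_phi !mulmxDl mulmxBr mulmxDr !mulmxA.
by rewrite [RHS]addrACA subrr addr0 !addrA.
Qed.

Lemma cov_at_cst_mulphi x u v : A x ->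
  nab x u (fun y => v *m f y) = v *m Gam x u *m f x + v *m T x u.
Proof.
move=> Ax; rewrite -cov_at_cst; apply: cov_at_mulphi => //; exact: differentiable_cst.
Qed.

Lemma smooth_mulphi Y : smooth_on A Y -> smooth_on A (fun y => Y y *m f y).
Proof. by move=> sY; apply: smooth_on_mulmx => //; exact: ef_smooth. Qed.

(** Compatibility of the metric with phi, applied to [u] and [v *m f x], where the square of phi is
    minus the identity up to a multiple of xi. *)
Lemma phi_skew x u v : A x -> <<x; u *m f x, v>> = - <<x; u, v *m f x>>.
Proof.
move=> Ax; have := acm_compat acm Ax u (v *m f x).
rewrite (acm_sq acm Ax) (acm_eta_phi acm Ax) mulr0 subr0 => <-.
rewrite ipDr ipNr ipZr -(acm_eta acm Ax) [ev _ _ _ (app _ _ _ _)](acm_eta_phi acm Ax).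
by rewrite mulr0 addr0 opprK.
Qed.

Lemma phi_compat x u v : A x ->
  <<x; u *m f x, v *m f x>> = <<x; u, v>> - <<x; u, xi i x>> * <<x; v, xi i x>>.
Proof. by move=> Ax; rewrite -!(acm_eta acm Ax); exact: (acm_compat acm Ax). Qed.

Lemma phi_sq x u : A x -> u *m f x *m f x = - u + <<x; u, xi i x>> *: xi i x.
Proof. by move=> Ax; rewrite -(acm_eta acm Ax); exact: (acm_sq acm Ax). Qed.

Lemma phi_orth_xi x u : A x -> <<x; u *m f x, xi i x>> = 0.
Proof. by move=> Ax; rewrite -(acm_eta acm Ax); exact: (acm_eta_phi acm Ax). Qed.

Lemma derive_ip_eq x u Y Z Y' Z' : A x -> smooth_on A Y -> smooth_on A Z ->
  smooth_on A Y' -> smooth_on A Z' ->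
  (forall y, A y -> <<y; Y y, Z y>> = <<y; Y' y, Z' y>>) ->
  <<x; nab x u Y, Z x>> + <<x; Y x, nab x u Z>> =
  <<x; nab x u Y', Z' x>> + <<x; Y' x, nab x u Z'>>.
Proof.
move=> Ax sY sZ sY' sZ' E; rewrite -!(derive_ip nablaP)//.
exact/near_eq_derive/(open_near oA Ax).
Qed.

(** The covariant derivative of the skew-symmetry of phi. *)
Lemma nabla_phi_skew x u v w : A x -> <<x; v *m T x u, w>> = - <<x; w *m T x u, v>>.
Proof.
move=> Ax; have sc (a : 'rV[R]_n) := smooth_on_cst A a.
have E y : A y -> <<y; v *m f y, w>> = <<y; - v, w *m f y>>.
  by move=> Ay; rewrite ipNl phi_skew.
have := derive_ip_eq u Ax (smooth_mulphi (sc v)) (sc w) (sc (- v))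
  (smooth_mulphi (sc w)) E.
rewrite !cov_at_cst !cov_at_cst_mulphi// !ipDl !ipDr !mulNmx !ipNl !phi_skew//.
rewrite (ipC g v (w *m _) Ax); lra.
Qed.

(** This is [(nabla_u eta) (v)], the covariant derivative of the contact form. *)
Definition nabla_xi_form x u v : R := <<x; v, nab x u (xi i)>>.

Lemma smooth_xi : smooth_on A (xi i). Proof. exact: vf_smooth. Qed.

(** Closedness of eta on constant fields; the Christoffel terms cancel by symmetry. *)
Lemma nabla_xi_formC x u v : A x -> nabla_xi_form x u v = nabla_xi_form x v u.
Proof.
move=> Ax; have sc (a : 'rV[R]_n) := smooth_on_cst A a.
have := cosymplectic_eta cosym (sc u) (sc v) Ax.
have E (a b : 'rV[R]_n) : 'D_a (fun y => ev eta i y b) x =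
    <<x; b *m Gam x a, xi i x>> + nabla_xi_form x a b.
  rewrite -cov_at_cst -derive_ip//; last exact: smooth_xi.
  by apply/near_eq_derive/(open_near oA Ax) => // y Ay; exact: (acm_eta acm Ay).
rewrite /deta /lie !derive_cst subrr !E /ev mul0mx mxE subr0.
by rewrite (christoffelC nablaP _ _ Ax); lra.
Qed.

(** The covariant derivative of [phi xi = 0]. *)
Lemma xi_nabla_phi x u : A x -> xi i x *m T x u = - (nab x u (xi i) *m f x).
Proof.
move=> Ax; apply/eqP; rewrite -addr_eq0 addrC; apply/eqP.
have dxi : differentiable (xi i) x by exact: smooth_on_diff smooth_xi Ax.
rewrite -(cov_at_mulphi u Ax dxi) -[RHS](mul0mx _ (Gam x u)) -cov_at_cst.
by apply: cov_at_eq => // y; exact: (acm_phi_xi acm).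
Qed.

(** The covariant derivative of the compatibility of the metric with phi. *)
Lemma nabla_phi_compat x u v w : A x ->
  <<x; v *m T x u, w *m f x>> + <<x; w *m T x u, v *m f x>> =
  - nabla_xi_form x u v * <<x; w, xi i x>> - nabla_xi_form x u w * <<x; v, xi i x>>.
Proof.
move=> Ax; have sc (a : 'rV[R]_n) := smooth_on_cst A a.
have sm a := smooth_mulphi (sc a).
have E : 'D_u (fun y => <<y; v *m f y, w *m f y>>) x =
    'D_u (fun y => <<y; v, w>> - <<y; v, xi i y>> * <<y; w, xi i y>>) x.
  by apply/near_eq_derive/(open_near oA Ax) => // y Ay; exact: phi_compat.
have dip Y Z : smooth_on A Y -> smooth_on A Z ->
    derivable (fun y => <<y; Y y, Z y>>) x u.
  by move=> sY sZ; apply/diff_derivable/smooth_on_diff/Ax/smooth_on_ip.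
move: E; rewrite (derive_ip nablaP)// deriveB; last 2 first.
- exact: dip.
- by apply: derivableM; apply: dip => //; exact: smooth_xi.
rewrite deriveM; try by apply: dip => //; exact: smooth_xi.
rewrite !(derive_ip nablaP)//; try exact: smooth_xi.
rewrite !cov_at_cst !cov_at_cst_mulphi// !ipDl !ipDr !phi_compat//.
rewrite /nabla_xi_form /GRing.scale/=.
rewrite (ipC g (v *m f x) (w *m T x u) Ax).
by rewrite /cov_at !ipDr; lra.
Qed.

(** This is [dPhi = 0] on constant fields: the brackets vanish, and the Christoffel terms cancel in
    pairs by their symmetry and the skewness of phi. *)
Lemma nabla_phi_cyc x u v w : A x ->
  <<x; v *m T x u, w>> + <<x; w *m T x v, u>> + <<x; u *m T x w, v>> = 0.
Proof.
move=> Ax; have sc (a : 'rV[R]_n) := smooth_on_cst A a.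
have := cosymplectic_Phi cosym (sc u) (sc v) (sc w) Ax.
rewrite /dPhi /lie !derive_cst !subrr /Phi !ip0l !subr0.
rewrite !(derive_ip nablaP)//; try exact: smooth_mulphi.
rewrite !cov_at_cst !cov_at_cst_mulphi// !ipDr.
rewrite (christoffelC nablaP u v Ax) (christoffelC nablaP v w Ax).
rewrite (christoffelC nablaP w u Ax).
have S a b c : <<x; a, b *m Gam x c *m f x>> = - <<x; b *m Gam x c, a *m f x>>.
  by rewrite -phi_skew// ipC.
have C a b c : <<x; a, b *m T x c>> = - <<x; a *m T x c, b>>.
  by rewrite ipC// nabla_phi_skew.
by rewrite !S !C; lra.
Qed.

(** As eta is closed, normality says that the Nijenhuis tensor vanishes. On constant fields it
    contains only ordinary derivatives of phi, which the symmetry of the Christoffel symbols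
    completes to covariant ones. *)
Lemma nabla_phi_nijenhuis x u v : A x ->
  v *m T x (u *m f x) - u *m T x (v *m f x) =
  v *m T x u *m f x - u *m T x v *m f x.
Proof.
move=> Ax; have sc (a : 'rV[R]_n) := smooth_on_cst A a.
have dphi : differentiable f x by exact: smooth_on_diff (@ef_smooth _ _ _ phi i) Ax.
have := cosymplectic_normal cosym (sc u) (sc v) Ax.
rewrite (cosymplectic_eta cosym)// scale0r addr0 /nijenhuis /lie /appf /app.
rewrite !derive_cst subr0 !mul0mx add0r !derive_mulmxl// sub0r subr0 mulNmx opprK.
move=> N; apply/eqP; rewrite -subr_eq0 -N; apply/eqP.
rewrite /T !(mulmxDr, mulmxDl, mulmxN, mulNmx, mulmxA).
rewrite (christoffelC nablaP (u *m f x) (v *m f x))//.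
rewrite (christoffelC nablaP (u *m f x) v)// (christoffelC nablaP (v *m f x) u)//.
rewrite (christoffelC nablaP u v)//.
(* The terms [b], [c], [e] and [q] are the Christoffel terms, which cancel in pairs; the other four
   are the derivatives of phi. *)
have E (a b c d e p q r : 'rV[R]_n) : a + b - c - (d + b - e) -
    (p + e - q - (r + c - q)) = a - d + r - p.
  by apply/rowP => j; rewrite !mxE; ring.
exact: E.
Qed.

(* Blair's formula: the sum of the relations below expresses
   [2 g((nabla_u phi) v, z)] through [dPhi], the Nijenhuis tensor and the
   symmetric form [nabla_xi_form], whose contributions cancel. *)
Lemma nabla_phi_eq0 x u v : A x -> v *m T x u = 0.
Proof.
move=> Ax; set z := v *m T x u; apply/eqP; rewrite -(ip_eq0 g _ Ax); apply/eqP.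
rewrite {1}/z; move: z => z.
have B1 a b c := nabla_phi_skew a b c Ax.
have N := congr1 (fun r => <<x; r, u *m f x>>) (nabla_phi_nijenhuis v z Ax).
move: N; rewrite /= !ipDl !ipNl !phi_compat//.
have := nabla_phi_cyc u v z Ax; have := nabla_phi_cyc u (v *m f x) (z *m f x) Ax.
have := nabla_phi_compat (v *m f x) z u Ax; have := nabla_phi_compat (z *m f x) v u Ax.
have := nabla_phi_compat u (v *m f x) z Ax.
rewrite !phi_sq// !ipDr !ipNr !ipZr !phi_orth_xi//.
have s1 a b : <<x; a *m T x b, xi i x>> = - nabla_xi_form x b (a *m f x).
  by rewrite B1 xi_nabla_phi// ipNl opprK phi_skew// ipC.
have sC a b := nabla_xi_formC a b Ax.
rewrite !s1 !(sC (v *m f x) u) !(sC (z *m f x) u) (sC (z *m f x) v) (sC (v *m f x) z).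
rewrite (B1 _ z v) (B1 _ u v) (B1 _ u (v *m f x)) (B1 _ (z *m f x) u).
lra.
Qed.

Lemma cov_at_phi x u Y : A x -> differentiable Y x ->
  nab x u (fun y => Y y *m f y) = nab x u Y *m f x.
Proof. by move=> Ax dY; rewrite cov_at_mulphi// nabla_phi_eq0// addr0. Qed.

(** Since phi is parallel, phi kills [nabla_u xi], which is thus a multiple of xi; it is also
    orthogonal to xi because xi has constant length. *)
Lemma cov_at_xi x u : A x -> nab x u (xi i) = 0.
Proof.
move=> Ax; apply/eqP; rewrite -(ip_eq0 g _ Ax); apply/eqP.
have xi_ip y : A y -> <<y; xi i y, xi i y>> = 1.
  by move=> Ay; rewrite -(acm_eta acm Ay); exact: (acm_eta_xi acm Ay).
have := derive_ip_cst nablaP u Ax smooth_xi smooth_xi xi_ip.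
rewrite (ipC g (xi i x) _ Ax) => nab_xi_xi.
have := phi_compat (nab x u (xi i)) (nab x u (xi i)) Ax.
have := xi_nabla_phi u Ax; rewrite nabla_phi_eq0// => /esym/eqP.
rewrite oppr_eq0 => /eqP ->.
rewrite ip0l; nra.
Qed.

End Cosymplectic.

(** * The vertical projection *)

Section KernelProjection.
Context {R : realFieldType} {n k : nat} (G : 'M[R]_n) (J : 'M[R]_(n, k)).
Hypothesis G_sym : G^T = G.
Hypothesis G_pos : forall u : 'rV[R]_n, u != 0 -> 0 < (u *m G *m u^T) 0 0.
Hypothesis J_rank : \rank J = k.

(** For the Jacobian [J] of a map, the rows of [J^T *m invmx G] are the gradients of its components.
    They span the orthogonal complement of the kernel, and this is their Gram matrix. *)
Definition gram : 'M[R]_k := J^T *m invmx G *m J.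

(** From [u] one subtracts the combination of these gradients that has the same image under [J]. The
    closed formula is what makes smoothness visible. *)
Definition ker_proj : 'M[R]_n := 1%:M - J *m invmx gram *m J^T *m invmx G.

Lemma posdef_unitmx : G \in unitmx.
Proof.
rewrite unitmxE unitfE; apply/negP => /det0P[v v0 vG].
by have := G_pos v0; rewrite vG mul0mx mxE ltxx.
Qed.

(** The quadratic form of [gram] at [w] is the squared length of [w *m J^T *m invmx G], which is
    nonzero for [w] nonzero because [J] has full column rank. *)
Lemma gram_unitmx : gram \in unitmx.
Proof.
have GU := posdef_unitmx.
rewrite unitmxE unitfE; apply/negP => /det0P[w w0 wK].
have JT0 : w *m J^T != 0 by rewrite mulmx_free_eq0// /row_free mxrank_tr J_rank.
have u0 : w *m J^T *m invmx G != 0.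
  by apply: contra JT0 => /eqP/(congr1 (mulmx^~ G)); rewrite mulmxKV// mul0mx => ->.
have := G_pos u0; rewrite mulmxKV// !trmx_mul trmxK trmx_inv G_sym !mulmxA.
have : w *m gram *m w^T = 0 by rewrite wK mul0mx.
by rewrite /gram !mulmxA => ->; rewrite mxE ltxx.
Qed.

Lemma ker_proj_mul : ker_proj *m J = 0.
Proof.
rewrite mulmxBl mul1mx -!mulmxA [J^T *m _]mulmxA -/gram mulVmx ?mulmx1 ?subrr//.
exact: gram_unitmx.
Qed.

Lemma ker_proj_orth (u v : 'rV[R]_n) : v *m J = 0 ->
  (u - u *m ker_proj) *m G *m v^T = 0.
Proof.
move=> vJ; rewrite /ker_proj mulmxBr mulmx1 opprB addrC subrK !mulmxA.
by rewrite mulmxKV ?posdef_unitmx// -[LHS]mulmxA -(trmx_mul v J) vJ trmx0 mulmx0.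
Qed.

End KernelProjection.

Lemma derive_comm_mx {R : realType} {V : normedModType R} {p q : nat}
    (A : set V) (f : V -> 'M[R]_(p, q)) x u v : open A -> A x ->
  smooth_on A f -> 'D_u ('D_v f) x = 'D_v ('D_u f) x.
Proof.
move=> oA Ax sf; have sD w := smooth_on_derive w sf.
have sfij a b k : Ck_on k A (fun y => f y a b) by exact: ((Ck_on_mxP _ _ oA).1 (sf k)).
have H a b w w' : 'D_w (fun y => ('D_w' f y) a b) x = 'D_w ('D_w' (fun y => f y a b)) x.
  apply: near_eq_derive; apply: (open_near oA Ax) => y Ay.
  by rewrite derive_coord//; exact: smooth_on_diff Ay.
have dD w : differentiable ('D_w f) x by exact: smooth_on_diff (sD w) Ax.
have E w w' a b : ('D_w ('D_w' f) x) a b = 'D_w ('D_w' (fun y => f y a b)) x.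
  exact: etrans (derive_coord w a b (dD w')) (H a b w w').
apply/matrixP => a b.
apply: etrans (E u v a b) _; apply: etrans _ (esym (E v u a b)).
exact: derive_comm u v oA Ax (sfij a b).
Qed.

Lemma smooth_on_jacobian {R : realType} {n k : nat} (A : set 'rV[R]_n)
    (f : 'rV[R]_n -> 'rV[R]_k) : open A -> smooth_on A f ->
  smooth_on A (fun x => 'J f x).
Proof.
move=> oA sf r; apply/(Ck_on_mxP _ _ oA) => a b.
have := (Ck_on_mxP _ _ oA).1 ((smooth_on_derive (delta_mx 0 a) sf) r) 0 b.
apply: (Ck_on_eq oA) => x /set_mem Ax /=.
by rewrite deriveEjacobian -?rowE ?mxE//; exact: smooth_on_diff Ax.
Qed.

Lemma crep_dom_open {R : realType} {n k : nat} {S T : topologicalType}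
    (a : chart R n S) (b : chart R k T) (F : S -> T) : continuous F ->
  open (crep_dom a b F).
Proof.
move=> cF; rewrite openE => x [ax bx].
have cont : {for x, continuous (F \o cinv a)}.
  by apply: continuous_comp; [exact: cinv_continuous|exact: cF].
have nx : nbhs x (img a) by apply: open_nbhs_nbhs; split=> //; exact: img_open.
have nFx : nbhs (F (cinv a x)) (dom b).
  by apply: open_nbhs_nbhs; split=> //; exact: dom_open.
exact: filterI nx (cont _ nFx).
Qed.

(** * Vertical and horizontal vectors of a submersion, and the smooth vertical projection *)

Section Submersion.
Context {R : realType} {n k : nat} {M : manifold R n} {N : manifold R k}
  (g : metric M) (gN : metric N) (F : M -> N).
Hypothesis Fsub : riemannian_submersion g gN F.
Variable i : idx M.
Implicit Types x y u v w : 'rV[R]_n.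
Implicit Types X Y Z V : 'rV[R]_n -> 'rV[R]_n.
Local Notation A := (region i).
Local Notation "<< x ; u , v >>" := (ip g i x u v).
Local Notation O j := (crep_dom (atlas i) (atlas j) F).
Local Notation psi j := (crep (atlas i) (atlas j) F).

Let oA : open A := @region_open _ _ _ i.

Lemma submersion_dom_open (j : idx N) : open (O j).
Proof. exact/crep_dom_open/(rs_smooth Fsub).1. Qed.

Lemma submersion_smooth j : smooth_on (O j) (psi j).
Proof. exact: (rs_smooth Fsub).2. Qed.

Lemma crep_region j x : O j x -> region j (psi j x).
Proof. by move=> [_ Fx]; exists (F (cinv (atlas i) x)). Qed.

Lemma crep_dom_cover x : A x -> exists j, O j x.
Proof.
by move=> Ax; have [j Fx] := atlas_cover (F (cinv (atlas i) x)); exists j.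
Qed.

(** By the chain rule through a transition map of the target, one chart around the image point
    decides verticality. *)
Lemma verticalP j x u : O j x -> vertical F i x u <-> u *m 'J (psi j) x = 0.
Proof.
move=> Ox; split=> [|uJ j' Ox']; first exact.
have xjj' : overlap j j' (psi j x).
  split; first exact: crep_region.
  by rewrite /= /crep cmapK; [exact: Ox'.2|exact: Ox.2].
have d1 : differentiable (psi j) x by exact: smooth_on_diff (@submersion_smooth j) Ox.
have d2 : differentiable (trans j j') (psi j x).
  exact: smooth_on_diff (atlas_compat j j') xjj'.
have E : {near x, trans j j' \o psi j =1 psi j'}.
  apply: (open_near (@submersion_dom_open j) Ox) => y Oy.
  by rewrite /= /trans /crep cmapK//; exact: Oy.2.
rewrite /pushforward -deriveEjacobian; last first.
  exact: smooth_on_diff (@submersion_smooth j') Ox'.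
rewrite -(near_eq_derive _ E) deriveE; last exact: differentiable_comp.
rewrite diff_comp//= -[X in 'd _ _ X](deriveE _ d1) deriveEjacobian// uJ.
exact: linear0.
Qed.

Lemma horizontalP j x u : O j x -> horizontal g F i x u <->
  forall v, v *m 'J (psi j) x = 0 -> <<x; u, v>> = 0.
Proof.
by move=> Ox; split=> H v Hv; apply: H; apply/(verticalP _ Ox).
Qed.

Lemma verticalD x a u v : vertical F i x u -> vertical F i x v ->
  vertical F i x (a *: u + v).
Proof.
by move=> uV vV j Ox; rewrite mulmxDl -scalemxAl uV// vV// scaler0 addr0.
Qed.

Lemma horizontalD x a u v : horizontal g F i x u -> horizontal g F i x v ->
  horizontal g F i x (a *: u + v).
Proof. by move=> uH vH w wV; rewrite ipDl ipZl uH// vH// mulr0 addr0. Qed.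

Lemma vertical_horizontal_eq0 x u : A x -> vertical F i x u ->
  horizontal g F i x u -> u = 0.
Proof. by move=> Ax uV uH; apply/eqP; rewrite -(ip_eq0 g _ Ax) uH. Qed.

Definition local_proj j x : 'M[R]_n := ker_proj (g i x) ('J (psi j) x).

(** A characterisation that mentions no chart of the target, so that the local formulas can be
    glued. *)
Definition is_vproj x (P : 'M[R]_n) :=
  forall u, vertical F i x (u *m P) /\ horizontal g F i x (u - u *m P).

Lemma local_projP j x : O j x -> is_vproj x (local_proj j x).
Proof.
move=> Ox; have Ax : A x := Ox.1; have rkJ := rs_rank Fsub Ox.
move=> u; split.
  apply/(verticalP _ Ox); rewrite -mulmxA ker_proj_mul ?mulmx0//.
    exact: g_sym.
  exact: g_pos.
apply/(horizontalP _ Ox) => v vJ; rewrite /ip ker_proj_orth// ?mxE//.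
exact: g_pos.
Qed.

(** The difference of two such projections of a vector is both vertical and horizontal. *)
Lemma is_vproj_unique x P Q : A x -> is_vproj x P -> is_vproj x Q -> P = Q.
Proof.
move=> Ax HP HQ; apply/row_matrixP => a; rewrite !rowE; set u := delta_mx _ _.
apply/eqP; rewrite -subr_eq0 addrC -scaleN1r; apply/eqP.
apply: (vertical_horizontal_eq0 Ax).
  by apply: verticalD; [exact: (HQ u).1|exact: (HP u).1].
have -> : -1 *: (u *m Q) + u *m P = -1 *: (u - u *m P) + (u - u *m Q).
  by rewrite !scaleN1r opprB subrKA addrC.
by apply: horizontalD; [exact: (HP u).2|exact: (HQ u).2].
Qed.

(* The charts of N around the image of x vary with x, hence the choice. *)
Definition vproj x : 'M[R]_n := get (is_vproj x).

Lemma vprojP x : A x -> is_vproj x (vproj x).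
Proof.
by move=> /crep_dom_cover[j /local_projP Px]; apply: getPex; exists (local_proj j x).
Qed.

Lemma vprojE j x : O j x -> local_proj j x = vproj x.
Proof.
by move=> Ox; apply: (is_vproj_unique Ox.1); [exact: local_projP|exact/vprojP/Ox.1].
Qed.

(** On each [O j] the projection is the explicit [local_proj j], built from the metric and the
    Jacobian by products, transposes and inverses. *)
Lemma vproj_smooth : smooth_on A vproj.
Proof.
move=> r; apply: Ck_on_local => x /crep_dom_cover[j Ox]; exists (O j) => //.
have oO := @submersion_dom_open j.
have E : {in O j, local_proj j =1 vproj} by move=> y /set_mem; exact: vprojE.
apply: (Ck_on_eq oO E).
have cJ : Ck_on r (O j) (fun y => 'J (psi j) y).
  exact: smooth_on_jacobian (@submersion_smooth j) r.
have cG : Ck_on r (O j) (fun y => invmx (g i y)).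
  apply: Ck_on_invmx => //.
    by move=> y [Ay _]; apply: posdef_unitmx; exact: g_pos.
  by apply: (@Ck_on_sub _ _ _ _ _ A); [move=> y []|exact: g_smooth].
have cJTG : Ck_on r (O j) (fun y => ('J (psi j) y)^T *m invmx (g i y)).
  by apply: Ck_on_mulmx => //; exact: Ck_on_trmx.
have cK : Ck_on r (O j) (fun y => invmx (gram (g i y) ('J (psi j) y))).
  apply: Ck_on_invmx => //; last exact: Ck_on_mulmx.
  move=> y Oy; apply: gram_unitmx; [exact/g_sym/Oy.1|exact/g_pos/Oy.1|].
  exact: rs_rank Fsub _ _ _ Oy.
have cL := Ck_on_mulmx oO (Ck_on_mulmx oO cJ cK) cJTG.
have := Ck_onD oO (Ck_on_cst r (O j) 1%:M)
  (Ck_on_mulmx oO cL (Ck_on_cst r (O j) (-1)%:M)).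
apply: (Ck_on_eq oO) => y _ /=.
by rewrite /local_proj /ker_proj mul_mx_scalar scaleN1r !mulmxA.
Qed.

End Submersion.

(** * Vanishing of the tensor A *)

Section Fibres.
Context {R : realType} {n k : nat} {M : manifold R n} {N : manifold R k}
  (g : metric M) (gN : metric N) (F : M -> N) (nabla : connection M).
Hypothesis nablaP : levi_civita g nabla.
Hypothesis Fsub : riemannian_submersion g gN F.
Variable i : idx M.
Implicit Types x y u v w : 'rV[R]_n.
Implicit Types X Y Z V : 'rV[R]_n -> 'rV[R]_n.
Local Notation A := (region i).
Local Notation "<< x ; u , v >>" := (ip g i x u v).
Local Notation O j := (crep_dom (atlas i) (atlas j) F).
Local Notation psi j := (crep (atlas i) (atlas j) F).
Local Notation Gam := (christoffel nabla i).
Local Notation nab := (cov_at nabla i).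
Local Notation P := (vproj g F i).

Let oA : open A := @region_open _ _ _ i.

(** Polarisation of the isometry condition. The vector [w] may be arbitrary: its vertical part is
    killed by the Jacobian and is orthogonal to [u]. *)
Lemma submersion_ip j x w u : O j x -> horizontal g F i x u ->
  ip gN j (psi j x) (w *m 'J (psi j) x) (u *m 'J (psi j) x) = <<x; w, u>>.
Proof.
move=> Ox uH; have Ax : A x := Ox.1.
have RNx := crep_region Ox.
have [wV wH] := vprojP Fsub Ax w; move: wV wH; set w1 := w *m P x.
move=> /(verticalP Fsub _ Ox) wV wH.
have -> : w *m 'J (psi j) x = (w - w1) *m 'J (psi j) x.
  by rewrite mulmxBl wV subr0.
have -> : <<x; w, u>> = <<x; w - w1, u>>.
  have uw1 : <<x; u, w1>> = 0 by apply: uH; exact/(verticalP Fsub _ Ox).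
  by rewrite [RHS]ipDl ipNl (ipC g w1 u Ax) uw1 oppr0 addr0.
move: (w - w1) wH => {w1 wV}w wH.
have := rs_isometry Fsub Ox (horizontalD 1 uH wH).
have := rs_isometry Fsub Ox uH; have := rs_isometry Fsub Ox wH.
rewrite /pushforward scale1r mulmxDl !ipDl !ipDr.
rewrite (ipC gN (u *m _) (w *m _) RNx) (ipC g u w Ax).
lra.
Qed.

(* [g] restricted to horizontal vectors is pulled back from [N], so its Lie
   derivative along the vertical field [V] vanishes on horizontal vectors. *)
Lemma cov_at_vertical_quad x u V : A x -> smooth_on A V ->
  (forall y, A y -> vertical F i y (V y)) -> horizontal g F i x u ->
  <<x; nab x u V, u>> = 0.
Proof.
move=> Ax sV VV uH; have [j Ox] := crep_dom_cover F Ax.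
have oO : open (O j) := @submersion_dom_open _ _ _ _ _ _ _ _ Fsub i j.
have RNx := crep_region Ox.
have spsi : smooth_on (O j) (psi j) := submersion_smooth Fsub i j.
have dJ : differentiable (fun y => 'J (psi j) y) x.
  exact: smooth_on_diff (smooth_on_jacobian oO spsi) Ox.
have dV : differentiable V x by exact: smooth_on_diff sV Ax.
have dpsi : differentiable (psi j) x by exact: smooth_on_diff spsi Ox.
pose v := V x.
have vJ : v *m 'J (psi j) x = 0 by apply/(verticalP Fsub _ Ox)/VV.
(* Exchanging the derivatives leaves [v] times the derivative of the Jacobian along [u];
   differentiating [V *m 'J (psi j) = 0] along [u] evaluates it. *)
have comm : 'D_v ('D_u (psi j)) x = - ('D_u V x *m 'J (psi j) x).
  rewrite (derive_comm_mx v u oO Ox spsi).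
  have -> : 'D_u ('D_v (psi j)) x = v *m 'D_u (fun y => 'J (psi j) y) x.
    rewrite -derive_mulmxl//; apply: near_eq_derive; apply: (open_near oO Ox) => y Oy.
    by apply: deriveEjacobian; exact: smooth_on_diff spsi Oy.
  apply/eqP; rewrite -addr_eq0 addrC -derive_mulmx//; apply/eqP.
  rewrite -[RHS](derive_cst (0 : 'rV[R]_k) x u).
  apply: near_eq_derive; apply: (open_near oO Ox) => y Oy.
  by apply/(verticalP Fsub _ Oy)/VV; exact: Oy.1.
pose h y := gN j (psi j y).
have dgN : differentiable (gN j) (psi j x).
  exact: smooth_on_diff (@g_smooth _ _ _ gN j) RNx.
have dh : differentiable h x by exact: differentiable_comp.
(* The metric of the target, read along [psi j], is stationary in the direction [v], which the
   Jacobian kills. *)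
have Dh : 'D_v h x = 0.
  rewrite deriveE// (diff_comp dpsi dgN)/= -(deriveE v dpsi) deriveEjacobian// vJ.
  exact: linear0.
(* The constant field [u] is known to be horizontal only at [x], so its vertical part [uP] is
   subtracted elsewhere. Since [uP] vanishes at [x], the correction [<<y; uP y, uP y>>] has zero
   derivative there. *)
pose uP y := u *m P y.
have suP : smooth_on A uP.
  exact: (smooth_on_mulmx oA (smooth_on_cst A u) (vproj_smooth Fsub i)).
have uP0 : uP x = 0.
  apply: (vertical_horizontal_eq0 (g := g) Ax); first exact: (vprojP Fsub Ax u).1.
  have -> : uP x = -1 *: (u - uP x) + u by rewrite scaleN1r opprB subrK.
  by apply: horizontalD => //; exact: (vprojP Fsub Ax u).2.
have E : {near x, (fun y => ('D_u (psi j) y *m h y *m ('D_u (psi j) y)^T) 0 0) =1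
    fun y => <<y; u, u>> - <<y; uP y, uP y>>}.
  apply: (open_near oO Ox) => y Oy /=; have [uV uH'] := vprojP Fsub Oy.1 u.
  have Ey : 'D_u (psi j) y = u *m 'J (psi j) y.
    by apply: deriveEjacobian; exact: smooth_on_diff spsi Oy.
  have -> : 'D_u (psi j) y = (u - uP y) *m 'J (psi j) y.
    by rewrite mulmxBl ((verticalP Fsub _ Oy).1 uV) subr0.
  rewrite [LHS](rs_isometry Fsub Oy uH').
  have := uH' _ uV; rewrite -/(uP y) !ipDl !ipDr !ipNl !ipNr (ipC g (uP y) u Oy.1).
  lra.
have dDu : differentiable ('D_u (psi j)) x.
  exact: smooth_on_diff (smooth_on_derive u spsi) Ox.
have dDuh : differentiable (fun y => 'D_u (psi j) y *m h y) x.
  exact: differentiable_mulmx.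
have dDuT : differentiable (fun y => ('D_u (psi j) y)^T) x.
  exact: differentiable_trmx.
have := near_eq_derive v E.
rewrite -derive_coord; last exact: differentiable_mulmx.
rewrite derive_mulmx// derive_mulmx// derive_trmx// Dh mulmx0 addr0 comm.
have mE (p q : 'M[R]_1) : (- p - q) 0 0 = - p 0 0 - q 0 0 by rewrite !mxE.
rewrite linearN/= !mulNmx mulmxN mE.
have := submersion_ip ('D_u V x) Ox uH; rewrite -(deriveEjacobian u dpsi) => DV.
have DV1 : ('D_u V x *m 'J (psi j) x *m h x *m ('D_u (psi j) x)^T) 0 0 =
  <<x; 'D_u V x, u>> := DV.
have DV2 : ('D_u (psi j) x *m h x *m ('D_u V x *m 'J (psi j) x)^T) 0 0 =
  <<x; 'D_u V x, u>> := etrans (ipC _ _ _ RNx) DV.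
rewrite DV1 DV2.
have sc (a : 'rV[R]_n) := smooth_on_cst A a.
rewrite deriveB; last 2 first.
- by apply/diff_derivable/smooth_on_diff/Ax/smooth_on_ip.
- by apply/diff_derivable/smooth_on_diff/Ax/smooth_on_ip.
(* The left side is minus twice the ['D_u V] part of [nab x u V] paired with [u]; the right side is
   twice its Christoffel part, by symmetry of the symbols. *)
rewrite !(derive_ip nablaP)// uP0 ip0l ip0r addr0 subr0 cov_at_cst.
rewrite (christoffelC nablaP v u Ax) (ipC g u _ Ax) /cov_at ipDl -/v.
lra.
Qed.

(** Polarisation of [cov_at_vertical_quad]. *)
Lemma cov_at_vertical_skew x u w V : A x -> smooth_on A V ->
  (forall y, A y -> vertical F i y (V y)) -> horizontal g F i x u ->
  horizontal g F i x w -> <<x; nab x u V, w>> = - <<x; nab x w V, u>>.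
Proof.
move=> Ax sV VV uH wH; have dV : differentiable V x by exact: smooth_on_diff sV Ax.
have := cov_at_vertical_quad Ax sV VV (horizontalD 1 uH wH).
rewrite (cov_at_linear _ _ _ _ _ dV) !scale1r (ipDl _ _ _ (nab x u V) (nab x w V)).
rewrite (ipDr _ _ _ (nab x u V) u w) (ipDr _ _ _ (nab x w V) u w).
rewrite !(cov_at_vertical_quad Ax sV VV)// add0r addr0; lra.
Qed.

Definition vertical_field V :=
  smooth_on A V /\ forall y, A y -> vertical F i y (V y).

(** Extends a vector that is vertical at one point to a vertical field on the whole chart, as
    required by hypotheses stated for fields. *)
Definition vext v y := v *m P y.

Lemma vext_vertical_field v : vertical_field (vext v).
Proof.
split=> [|y Ay]; last exact: (vprojP Fsub Ay v).1.
exact: (smooth_on_mulmx oA (smooth_on_cst A v) (vproj_smooth Fsub i)).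
Qed.

Lemma vext_id x v : A x -> vertical F i x v -> vext v x = v.
Proof.
move=> Ax vV; have [vPV vPH] := vprojP Fsub Ax v.
apply/esym/eqP; rewrite -subr_eq0; apply/eqP.
apply: (vertical_horizontal_eq0 (g := g) Ax) ; last exact: vPH.
have -> : v - vext v x = -1 *: vext v x + v by rewrite scaleN1r addrC.
exact: (verticalD (-1) vPV vV).
Qed.

(** * Parallelism of the vertical distribution and the curvature of vertical vectors *)

Section Anti_invariant.
Context (phi : endofield M) (xi : vfield M) (eta : oneform M).
Hypothesis cosym : cosymplectic phi xi eta g.
Hypothesis geodF : totally_geodesic_fibres nabla F.
Hypothesis splitF : horizontal_splitting phi xi g F.
Local Notation f := (phi i).

Lemma phi_horizontal x v : A x -> vertical F i x v ->
  horizontal g F i x (v *m f x).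
Proof.
move=> Ax vV; apply/((splitF Ax).1 _); exists v, 0; split=> //.
by rewrite scale0r addr0.
Qed.

Lemma vertical0 x : vertical F i x 0.
Proof. by move=> j _; rewrite mul0mx. Qed.

Lemma xi_horizontal x : A x -> horizontal g F i x (xi i x).
Proof.
move=> Ax; apply/((splitF Ax).1 _); exists 0, 1; split; first exact: vertical0.
by rewrite scale1r /app mul0mx add0r.
Qed.

(* As a trilinear form in X, Y, Z, this is skew under the exchange of X and Z
   and symmetric under that of Y and Z. *)
Lemma oneill_eq0 x X Y Z : A x ->
  vertical_field X -> vertical_field Y -> vertical_field Z ->
  <<x; nab x (X x *m f x) Y, Z x *m f x>> = 0.
Proof.
pose S X Y Z := <<x; nab x (X x *m f x) Y, Z x *m f x>>.
move=> Ax.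
have S13 X' Y' Z' : vertical_field X' -> vertical_field Y' ->
    vertical_field Z' -> S X' Y' Z' = - S Z' Y' X'.
  move=> [_ vX] [sY vY] [_ vZ].
  apply: (cov_at_vertical_skew Ax sY vY).
    exact: (phi_horizontal Ax (vX x Ax)).
  exact: (phi_horizontal Ax (vZ x Ax)).
have S23 X' Y' Z' : vertical_field X' -> vertical_field Y' ->
    vertical_field Z' -> S X' Y' Z' = S X' Z' Y'.
  move=> _ [sY vY] [sZ vZ].
  (* Differentiating this orthogonality and moving phi, which is parallel and skew, to the other
     argument exchanges [Y'] and [Z']. *)
  have YZ y : A y -> <<y; Y' y, Z' y *m f y>> = 0.
    by move=> Ay; rewrite ipC// (phi_horizontal Ay (vZ y Ay) (vY y Ay)).
  have := derive_ip_cst nablaP (X' x *m f x) Ax sY (smooth_mulphi phi sZ) YZ.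
  rewrite (cov_at_phi nablaP cosym _ Ax (smooth_on_diff sZ Ax)).
  rewrite (ipC g (Y' x) _ Ax) (phi_skew cosym _ _ Ax) -/(S X' Y' Z').
  by rewrite -/(S X' Z' Y'); lra.
move=> hX hY hZ; rewrite -/(S X Y Z).
(* Alternating the two exchanges six times returns to [S X Y Z] after three changes of sign, so it
   equals its opposite. *)
have := S13 _ _ _ hX hY hZ; have := S23 _ _ _ hZ hY hX.
have := S13 _ _ _ hZ hX hY; have := S23 _ _ _ hY hX hZ.
have := S13 _ _ _ hY hZ hX; have := S23 _ _ _ hX hZ hY.
lra.
Qed.

(** Differentiate the orthogonality of [Y] and xi, using that xi is parallel. *)
Lemma cov_at_vertical_orth_xi x u Y : A x -> vertical_field Y ->
  <<x; nab x u Y, xi i x>> = 0.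
Proof.
move=> Ax [sY vY]; have Yxi y : A y -> <<y; Y y, xi i y>> = 0.
  by move=> Ay; rewrite ipC// (xi_horizontal Ay (vY y Ay)).
have := derive_ip_cst nablaP u Ax sY (smooth_xi xi i) Yxi.
by rewrite (cov_at_xi nablaP cosym u Ax) ip0r addr0.
Qed.

(** The direction [u] splits into a vertical vector, a multiple of xi and the image by phi of a
    vertical vector. The first contributes nothing because the fibres are totally geodesic; skewness
    turns the second into a xi component, which vanishes; the third is [oneill_eq0]. *)
Lemma cov_at_vertical_orth_phi x u Y c : A x -> vertical_field Y ->
  vertical F i x c -> <<x; nab x u Y, c *m f x>> = 0.
Proof.
move=> Ax hY cV; have [sY vY] := hY; have dY := smooth_on_diff sY Ax.
have [uV uH] := vprojP Fsub Ax u.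
have [a [t [aV ua]]] := ((splitF Ax).1 _).1 uH.
have -> : u = 1 *: vext u x + (t *: xi i x + a *m f x).
  by rewrite scale1r [t *: _ + _]addrC -[a *m f x]/(app phi i x a) -ua addrC subrK.
have vc := vext_vertical_field c; have va := vext_vertical_field a.
have cE := vext_id Ax cV; have aE := vext_id Ax aV.
rewrite !(cov_at_linear _ _ _ _ _ dY) scale1r (ipDl _ _ _ (nab x (vext u x) Y)).
rewrite (ipDl _ _ _ (t *: _)) ipZl.
have -> : <<x; nab x (vext u x) Y, c *m f x>> = 0.
  have [su vu] := vext_vertical_field u.
  by rewrite ipC// (phi_horizontal Ax cV (geodF su sY vu vY Ax)).
have -> : <<x; nab x (xi i x) Y, c *m f x>> = 0.
  rewrite (cov_at_vertical_skew Ax sY vY (xi_horizontal Ax)) //; last first.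
    exact: phi_horizontal.
  by rewrite (cov_at_vertical_orth_xi _ Ax hY) oppr0.
have := oneill_eq0 Ax va hY vc; rewrite aE cE => ->.
by rewrite mulr0 !addr0.
Qed.

(** The horizontal part has the form [phi c + t xi], with [c] vertical. Its squared length is the
    pairing of [nab x u Y] with this vector, and both terms vanish. *)
Lemma cov_at_vertical x u Y : A x -> vertical_field Y ->
  vertical F i x (nab x u Y).
Proof.
move=> Ax hY; have [ZV ZH] := vprojP Fsub Ax (nab x u Y).
suff -> : nab x u Y = nab x u Y *m P x by [].
apply/eqP; rewrite -subr_eq0; apply/eqP; set Z := nab x u Y in ZV ZH *.
apply/eqP; rewrite -(ip_eq0 g _ Ax); apply/eqP.
have [c [t [cV Zc]]] := ((splitF Ax).1 _).1 ZH.
rewrite ipDl ipNl (ipC g (Z *m P x) _ Ax) (ZH _ ZV) oppr0 addr0 Zc ipDr ipZr.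
by rewrite (cov_at_vertical_orth_xi _ Ax hY) (cov_at_vertical_orth_phi _ Ax hY cV) mulr0
  addr0.
Qed.

Lemma cov_at_phi_orth_vertical x u Y c : A x -> vertical_field Y ->
  vertical F i x c -> <<x; nab x u (fun y => Y y *m f y), c>> = 0.
Proof.
move=> Ax hY cV; rewrite (cov_at_phi nablaP cosym _ Ax (smooth_on_diff hY.1 Ax)).
exact: (phi_horizontal Ax (cov_at_vertical u Ax hY) cV).
Qed.

(** Each of the three terms of the curvature is orthogonal to [E]. For an iterated derivative of
    [W], differentiate the orthogonality of [nabla_X W] and [E]: the other term pairs [nabla_X W],
    the image by phi of a vertical vector, with the vertical vector [nabla_u E]. *)
Lemma curvature_phi_vertical_eq0 x E : A x -> vertical_field E ->
  <<x; curvature nabla i E (appf phi i E) (appf phi i E) x, E x>> = 0.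
Proof.
move=> Ax hE; have [sE vE] := hE.
pose W y := E y *m f y; have sW : smooth_on A W := smooth_mulphi phi sE.
have H X u : smooth_on A X -> <<x; nab x u (cov nabla i X W), E x>> = 0.
  move=> sX; have XW y : A y -> <<y; cov nabla i X W y, E y>> = 0.
    by move=> Ay; exact: (cov_at_phi_orth_vertical _ Ay hE (vE y Ay)).
  have := derive_ip_cst nablaP u Ax (smooth_on_cov nabla sX sW) sE XW.
  have -> : <<x; cov nabla i X W x, nab x u E>> = 0.
    exact: (cov_at_phi_orth_vertical _ Ax hE (cov_at_vertical _ Ax hE)).
  by rewrite addr0.
have t1 : <<x; cov nabla i E (cov nabla i W W) x, E x>> = 0 := H W (E x) sW.
have t2 : <<x; cov nabla i W (cov nabla i E W) x, E x>> = 0 := H E (W x) sE.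
have t3 : <<x; cov nabla i (lie E W) W x, E x>> = 0 :=
  cov_at_phi_orth_vertical _ Ax hE (vE x Ax).
rewrite /curvature -[appf phi i E]/W (ipDl _ _ _ (_ - _)) (ipDl _ _ _ (cov _ _ _ _ _)).
by rewrite !ipNl t1 t2 t3 !subr0.
Qed.

End Anti_invariant.

End Fibres.

(* If no nonzero vector were vertical, every vector would be a multiple of
   [xi], although the dimension is at least 3. *)
Lemma vertical_neq0 (R : realType) (m : nat) (m_gt0 : (0 < m)%N)
    (M : manifold R m.*2.+1) (k : nat) (N : manifold R k) (phi : endofield M)
    (xi : vfield M) (g : metric M) (F : M -> N) (i : idx M) x :
  horizontal_splitting phi xi g F -> region i x ->
  exists2 v, vertical F i x v & v != 0.
Proof.
move=> splitF Ax; apply: contrapT => noV.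
have v0 v : vertical F i x v -> v = 0.
  by move=> vV; apply/eqP/negPn/negP => vN0; apply: noV; exists v.
have xi_all w : exists t, w = t *: xi i x.
  have wH : horizontal g F i x w by move=> v /v0 ->; rewrite ip0r.
  have [v [t [/v0 -> ->]]] := ((splitF i x Ax).1 w).1 wH.
  by exists t; rewrite /app mul0mx add0r.
have m1 : (1 < m.*2.+1)%N by rewrite ltnS double_gt0.
pose o := Ordinal m1.
have [s sE] := xi_all (delta_mx 0 0); have [t tE] := xi_all (delta_mx 0 o).
(* Two distinct basis vectors cannot both be multiples of xi: the component of xi at [o] would have
   to be zero and nonzero. *)
have := congr1 (fun w : 'rV_ _ => w 0 0) sE; rewrite !mxE eqxx/= => s0.
have := congr1 (fun w : 'rV_ _ => w 0 o) sE; rewrite !mxE eqxx/= => so.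
have := congr1 (fun w : 'rV_ _ => w 0 o) tE; rewrite !mxE eqxx/= => to.
have /eqP := esym so; rewrite mulf_eq0 => /orP[/eqP s_eq0|/eqP xi0].
  by have /eqP := s0; rewrite s_eq0 mul0r oner_eq0.
by have /eqP := to; rewrite xi0 mulr0 oner_eq0.
Qed.

Theorem corollary7 (R : realType) (m : nat) (m_gt0 : (0 < m)%N)
  (M : manifold R m.*2.+1)
  (phi : endofield M) (xi : vfield M) (eta : oneform M) (gM : metric M)
  (nabla : connection M) (c : R)
  (nablaP : levi_civita gM nabla)
  (M_cosymplectic : cosymplectic phi xi eta gM)
  (M_space_form : constant_phi_sectional phi xi gM nabla c)
  (c_neq0 : c <> 0) :
  ~ exists (k : nat) (N : manifold R k) (gN : metric N) (F : M -> N),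
      [/\ riemannian_submersion gM gN F,
          totally_geodesic_fibres nabla F
        & horizontal_splitting phi xi gM F].
Proof.
move=> [k [N [gN [F [Fsub geodF splitF]]]]]; apply: c_neq0.
have [p _] := manifold_nonempty M; have [i ip_] := atlas_cover p.
have Ax : region i (cmap (atlas i) p) by exists p.
move: (cmap (atlas i) p) Ax => x Ax.
have [w wV w0] := vertical_neq0 m_gt0 splitF Ax.
have ww : 0 < ip gM i x w w by exact: g_pos.
pose v := (Num.sqrt (ip gM i x w w))^-1 *: w.
have vV : vertical F i x v by move=> j Ox; rewrite -scalemxAl wV// scaler0.
have vv : ip gM i x v v = 1.
  rewrite ipZl ipZr mulrA -invfM -expr2 sqr_sqrtr ?ltW// mulVf//.
  by rewrite gt_eqF.
(* The curvature hypothesis takes a field with a unit value orthogonal to xi at [x]; the vertical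
   extension of [v] qualifies because xi is horizontal. *)
have hE := vext_vertical_field Fsub i v; have Ex := vext_id Fsub Ax vV.
rewrite -(M_space_form i _ hE.1 x Ax); last 2 first.
- by rewrite Ex.
- by rewrite Ex ipC// (xi_horizontal splitF Ax).
exact: (curvature_phi_vertical_eq0 nablaP Fsub M_cosymplectic geodF splitF Ax hE).
Qed.
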